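(* Let $d\ge 1$, $q_1,\dots,q_d$ be positive integers, $\Gamma=q_1\mathbb{Z}\oplus\cdots\oplus q_d\mathbb{Z}$, and let $V:\mathbb{Z}^d\to\mathbb{R}$ be a real-valued $\Gamma$-periodic function. Then the following statements are equivalent: (1) $V$ is a constant function. (2) There exists an entire function $f:\mathbb{C}^d\to\mathbb{C}$ such that $(k,f(k))\in B(\Delta+V)$ for all $k\in\mathbb{C}^d$.
   Context: A function $V$ on $\mathbb{Z}^d$ is $\Gamma$-periodic if $V(n+\gamma)=V(n)$ for all $n\in\mathbb{Z}^d$, $\gamma\in\Gamma$. The discrete Laplacian is $(\Delta u)(n)=\sum_{\|n'-n\|_1=1}u(n')$, where $\|n'-n\|_1=\sum_{l=1}^d|n_l-n'_l|$. Let $W=\{n=(n_1,\dots,n_d)\in\mathbb{Z}^d: 0\le n_j\le q_j-1,\ j=1,\dots,d\}$ and $Q=q_1q_2\cdots q_d$. Let $\mathbf{e}_j$ be the standard basis of $\mathbb{Z}^d$. For $k=(k_1,\dots,k_d)\in\mathbb{C}^d$, $D_V(k)$ is the $Q\times Q$ matrix representing $\Delta+V$ acting on the $Q$-dimensional space of functions $u:\mathbb{Z}^d\to\mathbb{C}$ satisfying the Floquet-Bloch condition $u(n+q_j\mathbf{e}_j)=e^{2\pi i k_j}u(n)$ for all $n\in\mathbb{Z}^d$, $j=1,\dots,d$, where $u$ is identified with its values $\{u(n)\}_{n\in W}$. The Bloch variety is $B(\Delta+V)=\{(k,\lambda)\in\mathbb{C}^d\times\mathbb{C}:\det(D_V(k)-\lambda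 I)=0\}$. *)

(* Defs.v *)
From HB Require Import structures.
From mathcomp Require Import all_boot all_order all_algebra.
From mathcomp Require Import complex.
From mathcomp Require Import zify ring lra.
From mathcomp Require Import all_classical all_reals all_analysis.

Set Implicit Arguments.
Unset Strict Implicit.
Unset Printing Implicit Defensive.
Import Order.TTheory GRing.Theory Num.Theory.
Import numFieldNormedType.Exports.

Local Open Scope classical_set_scope.
Local Open Scope ring_scope.
Local Open Scope complex_scope.

Notation zvec d := 'rV[int]_d.

Definition period_lattice (d : nat) (q : 'I_d -> nat) : set (zvec d) :=
  [set g : zvec d | forall j, ((q j)%:Z %| g 0%R j)%Z].

Definition lattice_periodic (T : Type) (d : nat) (q : 'I_d -> nat) (V : zvec d -> T) :=
  forall n g, period_lattice q g -> V (n + g) = V n.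

Definition norm1 (d : nat) (n : zvec d) : int := \sum_j `|n 0 j|.

Section Bloch.
Variables (R : realType) (d : nat) (q : 'I_d -> nat).
Local Notation C := R[i].
Implicit Types (k : 'rV[C]_d) (u : zvec d -> C) (V : zvec d -> R).

Definition cexp (z : C) : C :=
  (expR (complex.Re z))%:C * (cos (complex.Im z) +i* sin (complex.Im z)).

(* The index set of the sum is finite, see [laplacianE], so that the finitely
   supported sum is the genuine sum over all nearest neighbours of [n]. *)
Definition laplacian u (n : zvec d) : C :=
  \sum_(n' \in [set n' : zvec d | norm1 (n' - n) = 1]) u n'.

Definition schrodinger V u (n : zvec d) : C :=
  laplacian u n + (V n)%:C * u n.

Definition floquet_factor k (j : 'I_d) : C :=
  cexp (2 * pi%:C * 'i%C * k 0 j).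

Definition floquet k u := forall (n : zvec d) (j : 'I_d),
  u (n + (q j)%:Z *: delta_mx 0 j) = floquet_factor k j * u n.

Definition cell_index := {dffun forall j : 'I_d, 'I_(q j)}.

(* [cell] enumerates W, the points n of Z^d with 0 <= n_j <= q_j - 1. *)
Definition cell (a : 'I_#|{: cell_index}|) : zvec d :=
  \row_j (enum_val a j : nat)%:Z.

(* The Floquet-Bloch function with quasimomentum [k] that agrees with [u] on W;
   only the values of [u] on W matter ([floquet_ext_floquet],
   [floquet_extE]). *)
Definition floquet_ext k u (n : zvec d) : C :=
  (\prod_j floquet_factor k j ^ (n 0%R j %/ (q j)%:Z)%Z)
  * u (\row_j (n 0%R j %% (q j)%:Z)%Z).

(* Column [b] holds the values on W of the image under Delta + V of the
   Floquet-Bloch function equal to 1 at [cell b] and to 0 at the other points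
   of W; [floquet_mxP] states that this matrix represents Delta + V. *)
Definition floquet_mx V k : 'M[C]_#|{: cell_index}| :=
  \matrix_(a, b)
    schrodinger V (floquet_ext k (fun n => (n == cell b)%:R)) (cell a).

Definition bloch_variety V : set ('rV[C]_d * C) :=
  [set x | \det (floquet_mx V x.1 - (x.2)%:M) = 0].

(* Frechet differentiability over C; the regular algebra [C^o] carries the
   normed module structure of C over itself. *)
Definition entire (f : 'rV[C]_d -> C) :=
  forall k, differentiable (f : 'rV[C^o]_d -> C^o) (k : 'rV[C^o]_d).

Lemma card_cell_index : #|{: cell_index}| = (\prod_j q j)%N.
Proof.
rewrite card_dep_ffun foldrE big_map big_enum.
by under eq_bigr do rewrite card_ord.
Qed.

Lemma norm1_eq1 (m : zvec d) : norm1 m = 1 ->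
  exists j, m = delta_mx 0 j \/ m = - delta_mx 0 j.
Proof.
move=> m1; have [j mj0] : exists j, m 0 j != 0.
  apply: contrapT => /forallNP m0; move/eqP: m1; rewrite /norm1 big1 // => j _.
  by apply/eqP; rewrite normr_eq0; apply: contrapT => /negP/m0.
have s0 : 0 <= \sum_(i | i != j) `|m 0 i| by apply: sumr_ge0.
have n1 : 1 <= `|m 0 j| by rewrite -gtz0_ge1 normr_gt0.
move: m1; rewrite /norm1 (bigD1 j) //= => m1.
have mj : `|m 0 j| = 1 by move: m1 s0 n1; set A := \sum_(_ | _) _; lia.
have {}s0 : \sum_(i | i != j) `|m 0 i| = 0 by move: m1 mj; set A := \sum_(_ | _) _; lia.
have mi i : i != j -> m 0 i = 0.
  move=> ij; have := s0; rewrite (bigD1 i) //=.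
  have : 0 <= \sum_(l | (l != j) && (l != i)) `|m 0 l| by apply: sumr_ge0.
  by move: (\sum_(l | _) _); lia.
exists j; have [mj1|mj1] : m 0 j = 1 \/ m 0 j = - 1 by lia.
  left; apply/rowP => i; rewrite mxE eqxx /=.
  by case: eqVneq => [->//|/mi].
right; apply/rowP => i; rewrite !mxE eqxx /=.
by case: eqVneq => [->//|/mi ->]; rewrite oppr0.
Qed.

Lemma norm1_delta (j : 'I_d) : norm1 (delta_mx 0 j) = 1.
Proof.
rewrite /norm1 (bigD1 j) //= big1 ?mxE ?eqxx ?addr0 // => i ij.
by rewrite mxE eqxx (negbTE ij).
Qed.

Lemma norm1N (m : zvec d) : norm1 (- m) = norm1 m.
Proof. by apply: eq_bigr => j _; rewrite mxE normrN. Qed.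

Lemma laplacianE u n : laplacian u n =
  \sum_j (u (n + delta_mx 0 j) + u (n - delta_mx 0 j)).
Proof.
pose r := [seq n + delta_mx 0 j | j <- enum 'I_d] ++
          [seq n - delta_mx 0 j | j <- enum 'I_d].
have inj : injective (fun j : 'I_d => delta_mx 0 j : zvec d).
  move=> i j /rowP/(_ i); rewrite !mxE !eqxx /=.
  by case: eqVneq => // ->.
have ur : uniq r.
  have injp : injective (fun j : 'I_d => n + delta_mx 0 j).
    by move=> i j h; apply: inj; exact: addrI h.
  have injm : injective (fun j : 'I_d => n - delta_mx 0 j).
    by move=> i j h; apply: inj; apply: oppr_inj; exact: addrI h.
  rewrite cat_uniq (map_inj_uniq injp) (map_inj_uniq injm) enum_uniq /=.
  rewrite andbT; apply/hasPn => _ /mapP[i _ ->]; apply/mapP => -[j _].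
  move=> h; move: (addrI _ h) => /rowP/(_ i); rewrite !mxE !eqxx /=.
  by case: eqVneq.
have -> : laplacian u n = \sum_(x \in [set` r]) u x.
  apply: eq_fsbigl; apply/seteqP; split=> [x /= /norm1_eq1[j xj]|x /=].
    have -> : x = n + (x - n) by rewrite addrC subrK.
    rewrite mem_cat; apply/orP.
    by case: xj => ->; [left|right]; apply/mapP; exists j; rewrite ?mem_enum.
  rewrite mem_cat => /orP[] /mapP[j _ ->].
    by rewrite addrAC subrr add0r norm1_delta.
  by rewrite addrAC subrr add0r norm1N norm1_delta.
rewrite -fsbig_seq // big_cat !big_map big_split /=.
by congr (_ + _); rewrite -enumT big_enum.
Qed.

Lemma cexp_neq0 (z : C) : cexp z != 0.
Proof.
rewrite mulf_neq0 //; first by rewrite fmorph_eq0 gt_eqF // expR_gt0.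
apply/eqP => -[c0 s0]; have := cos2Dsin2 (complex.Im z).
by rewrite c0 s0 expr0n addr0 => /eqP; rewrite eq_sym oner_eq0.
Qed.

Lemma floquet_ext_floquet (q_gt0 : forall j, (0 < q j)%N) k u :
  floquet k (floquet_ext k u).
Proof.
move=> n j; rewrite /floquet_ext mulrA; congr (_ * u _); last first.
  apply/rowP => i; rewrite !mxE eqxx /=; case: eqVneq => [->|_].
    by rewrite mulr1 addrC modzDl.
  by rewrite mulr0 addr0.
rewrite [in RHS](bigD1 j) //= mulrA -{1}[floquet_factor k j]expr1z.
rewrite -expfzDr ?cexp_neq0 // (bigD1 j) //=; congr (_ ^ _ * _).
  rewrite !mxE !eqxx mulr1 divzDr ?dvdzz // divzz addrC.
  by have := q_gt0 j; case: (q j).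
by apply: eq_bigr => i ij; rewrite !mxE (negbTE ij) andbF mulr0 addr0.
Qed.

Lemma floquet_translate k u (n : zvec d) (j : 'I_d) (m : int) : floquet k u ->
  u (n + (m * (q j)%:Z) *: delta_mx 0 j) = floquet_factor k j ^ m * u n.
Proof.
move=> fu; have f0 : floquet_factor k j != 0 by exact: cexp_neq0.
elim: m n => [|m IH|m IH] n.
- by rewrite mul0r scale0r addr0 expr0z mul1r.
- rewrite intS mulrDl mul1r scalerDl addrA IH fu expfzDr // expr1z.
  by rewrite mulrCA mulrA.
- apply: (mulfI f0); rewrite -fu -addrA -scalerDl.
  have -> : - m.+1%:Z * q j + q j = - m%:Z * q j by lia.
  rewrite IH mulrA; congr (_ * _).
  by rewrite -{2}[floquet_factor k j]expr1z -expfzDr //; congr (_ ^ _); lia.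
Qed.

Lemma floquet_extE k u : floquet k u -> floquet_ext k u = u.
Proof.
move=> fu; apply/funext => n; rewrite /floquet_ext.
set r := \row_j _.
have rE : n = r + \sum_j ((n 0%R j %/ (q j)%:Z)%Z * (q j)%:Z) *: delta_mx 0 j.
  apply/rowP => i; rewrite !mxE summxE (bigD1 i) //= big1 ?addr0.
    by rewrite !mxE !eqxx mulr1 addrC -divz_eq.
  by move=> j ji; rewrite !mxE eq_sym (negbTE ji) andbF mulr0.
rewrite [in RHS]rE; elim/big_rec2: _ r {rE} => [|j x y _ IH] r.
  by rewrite addr0 mul1r.
by rewrite addrA -IH (floquet_translate _ _ _ fu) mulrCA mulrA.
Qed.

Lemma cell_inj : injective cell.
Proof.
move=> a b /rowP ab; apply: enum_val_inj; apply/ffunP => j; apply/val_inj.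
by have := ab j; rewrite !mxE => -[].
Qed.

Lemma cell_surj (q_gt0 : forall j, (0 < q j)%N) (n : zvec d) :
  exists b, cell b = \row_j (n 0%R j %% (q j)%:Z)%Z.
Proof.
have h j : (absz (n 0%R j %% (q j)%:Z)%Z < q j)%N.
  by have := q_gt0 j; have := ltz_mod (n 0%R j) (d := q j); lia.
exists (enum_rank ([ffun j => Ordinal (h j)] : cell_index)).
apply/rowP => j; rewrite !mxE enum_rankK ffunE /= gez0_abs // modz_ge0 //.
by have := q_gt0 j; lia.
Qed.

Lemma floquet_mxP (q_gt0 : forall j, (0 < q j)%N) V k u
    (a : 'I_#|{: cell_index}|) : floquet k u ->
  schrodinger V u (cell a) = \sum_b floquet_mx V k a b * u (cell b).
Proof.
move=> fu; pose e b := floquet_ext k (fun n => (n == cell b)%:R).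
have ue n : u n = \sum_b e b n * u (cell b).
  rewrite -[in LHS](floquet_extE fu) /e /floquet_ext.
  have [b <-] := cell_surj q_gt0 n.
  rewrite [RHS](bigD1 b) //= eqxx mulr1 [X in _ = _ + X]big1 ?addr0 // => c cb.
  by rewrite (inj_eq cell_inj) eq_sym (negbTE cb) mulr0 mul0r.
under eq_bigr do rewrite mxE -/(e _) /schrodinger laplacianE mulrDl mulr_suml.
rewrite big_split exchange_big /= /schrodinger laplacianE; congr (_ + _).
  apply: eq_bigr => j _; rewrite !ue -big_split; apply: eq_bigr => b _.
  by rewrite mulrDl.
by rewrite ue mulr_sumr; apply: eq_bigr => b _; rewrite mulrA.
Qed.

End Bloch.

(* Main.v *)
Require Import Defs.
From mathcomp Require Import all_boot all_order all_algebra.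
From mathcomp Require Import complex.
From mathcomp Require Import zify ring lra.
From mathcomp Require Import all_classical all_reals all_analysis.
Set Implicit Arguments.
Unset Strict Implicit.
Unset Printing Implicit Defensive.
Import Order.TTheory GRing.Theory Num.Theory.
Import numFieldNormedType.Exports.
Import Normc.
Local Open Scope classical_set_scope.
Local Open Scope ring_scope.
Local Open Scope complex_scope.

(** Write w_j = exp(2 i pi k_j / q_j) and A(k) = sum_j (w_j + 1 / w_j). For
    V = 0 the eigenvalues of D_V(k) are the numbers A(k + m), m in W, with plane
    waves as eigenfunctions, and a constant potential c adds c to each of them.
    Hence f = c + A is a suitable entire function when V is constant.

    Let conversely f(k) be an eigenvalue of D_V(k) for every complex k. In
    Fourier coefficients the Laplacian is a multiplication and the potential is
    bounded by a constant that does not depend on k, so that f(k) stays at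
    bounded distance from the set of all A(k + m) ([bloch_near_free]). Where the
    imaginary part of k_j is very negative, w_j dominates, and f / w_j is close
    to a q_j-th root of unity; this root cannot jump, since f is continuous and
    the region is convex ([leading_root]). The same holds for the coefficient of
    1 / w_j at the opposite end. Once these leading terms are subtracted, f is
    bounded in each variable separately, and Liouville's theorem gives
    f = l + sum_j (a_j w_j + b_j / w_j) ([near_free_laurent]).

    For real k the matrix D_V(k) is Hermitian, so f is real there, and b_j is the
    conjugate, that is the inverse, of a_j ([real_laurent_conj]). Therefore
    f(k) = l + A(k + s) for an integer vector s. As D_V(k) does not change when an
    integer vector is added to k, all the numbers l + A(k + m), m in W, are
    eigenvalues of D_V(k). They are distinct for a well chosen k
    ([simple_free_spectrum]), so they are the whole spectrum of D_V(k), as if V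
    were the constant l. The traces of D_V(k) and of its square then say that V
    has mean l and V^2 has mean l^2, whence V = l ([isospectral_const]).

    Liouville's theorem is derived here for functions that are merely complex
    differentiable at every point: Goursat's lemma comes from bisection, and
    Cauchy's formula is replaced by Goursat's lemma for difference quotients
    ([goursat_punctured], [liouville]). *)

(** * The complex plane as a normed space *)

Section ComplexPlane.
Variable R : realType.
Local Notation C := R[i].
Local Notation Co := (R[i])^o.
Implicit Types (z w : C) (x y t : R).

Lemma normcE_C z : `|z| = (normc z)%:C. Proof. by []. Qed.

Lemma normc_ge0 z : 0 <= normc z.
Proof. by rewrite -ler0c -normcE_C normr_ge0. Qed.

Lemma normc_gt0 z : z != 0 -> 0 < normc z.
Proof. by rewrite -normr_gt0 normcE_C -[0]/(0%:C) ltcR. Qed.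

Lemma ler_normcD z w : normc (z + w) <= normc z + normc w.
Proof. exact: le_normcD. Qed.

Lemma normcNE z : normc (- z) = normc z.
Proof. exact: normcN. Qed.

Lemma normcC z w : normc (z - w) = normc (w - z).
Proof. by rewrite -normcNE opprB. Qed.

Lemma ler_normcB z w : normc (z - w) <= normc z + normc w.
Proof. by rewrite -(normcNE w); exact: ler_normcD. Qed.

Lemma ler_normc_sum (I : Type) (r : seq I) (P : pred I) (F : I -> C) :
  normc (\sum_(i <- r | P i) F i) <= \sum_(i <- r | P i) normc (F i).
Proof.
elim/big_rec2: _ => [|i a b _ h]; first by rewrite normc0.
by apply: le_trans (ler_normcD _ _) _; rewrite lerD2l.
Qed.

Lemma ler_subnormc z w : normc z - normc w <= normc (z + w).
Proof.
by rewrite lerBlDr -(normcNE w) -{1}[z](addrK w); exact: ler_normcD.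
Qed.

Lemma normc_real x : normc x%:C = `|x|.
Proof. by rewrite /= expr0n addr0 sqrtr_sqr. Qed.

Lemma Re_le_normc z : `|complex.Re z| <= normc z.
Proof. by rewrite -lecR -normcE_C normc_ge_Re. Qed.

Lemma Im_le_normc z : `|complex.Im z| <= normc z.
Proof.
case: z => a b; rewrite /= -(sqrtr_sqr b) ler_sqrt; last first.
  by rewrite addr_ge0 ?sqr_ge0.
by rewrite lerDr sqr_ge0.
Qed.

Lemma normc_le_ReIm x y : normc (x +i* y) <= `|x| + `|y|.
Proof.
have -> : x +i* y = x%:C + y%:C * 'i%C by simpc.
apply: le_trans (ler_normcD _ _) _.
by rewrite normcM !normc_real /= expr0n expr1n add0r sqrtr1 mulr1.
Qed.

Lemma normc_lt z (e : R) : (`|z| < e%:C) = (normc z < e).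
Proof. by rewrite normcE_C ltcR. Qed.

Lemma pos_complex (e : C) : 0 < e -> exists2 r : R, 0 < r & e = r%:C.
Proof.
case: e => a b; rewrite ltcE /= => /andP[/eqP b0 a0].
by exists a => //; rewrite b0.
Qed.

(** Balls of [C^o] have complex radii; being positive, such a radius is real, so
    that estimates can be carried out in [R] with [normc]. *)
Lemma nbhs_normcP (z : Co) (P : set Co) :
  nbhs z P <-> exists2 e : R, 0 < e & forall w, normc (w - z) < e -> P w.
Proof.
split=> [/nbhs_ballP[e /= /pos_complex[r r0 ->]] zP|[e e0 zP]].
  by exists r => // w wz; apply: zP; rewrite -ball_normE /= normc_lt normcC.
apply/nbhs_ballP; exists e%:C; first by rewrite /= ltcR.
by move=> w; rewrite -ball_normE /= normc_lt normcC => /zP.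
Qed.

Lemma cvg_normcP (T : Type) (F : set_system T) (FF : Filter F) (f : T -> Co) (l : Co) :
  f x @[x --> F] --> l <-> forall e : R, 0 < e -> \forall x \near F, normc (f x - l) < e.
Proof.
split=> [/cvgrPdist_lt fl e e0|fl].
  have : 0 < e%:C by rewrite ltcR.
  by move=> /fl; apply: filterS => x; rewrite normc_lt normcC.
apply/cvgrPdist_lt => _ /pos_complex[e e0 ->].
by apply: filterS (fl _ e0) => x; rewrite normc_lt normcC.
Qed.

Lemma continuous_Re : continuous (fun z : Co => complex.Re z : R).
Proof.
move=> z; apply/(@cvgrPdist_lt _ _ _ _ (nbhs_filter z)) => e e0.
apply/nbhs_normcP; exists e => // w.
by rewrite normcC; apply: le_lt_trans; rewrite -raddfB Re_le_normc.
Qed.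

Lemma continuous_Im : continuous (fun z : Co => complex.Im z : R).
Proof.
move=> z; apply/(@cvgrPdist_lt _ _ _ _ (nbhs_filter z)) => e e0.
apply/nbhs_normcP; exists e => // w.
by rewrite normcC; apply: le_lt_trans; rewrite -raddfB Im_le_normc.
Qed.

Lemma continuous_hline y : continuous (fun x => x +i* y : Co).
Proof.
move=> x; apply/cvg_normcP => e e0.
have /cvgrPdist_lt/(_ e e0) : t @[t --> x] --> x by [].
apply: filterS => t; apply: le_lt_trans.
by apply: le_trans (normc_le_ReIm _ _) _; rewrite subrr normr0 addr0 distrC.
Qed.

Lemma continuous_vline x : continuous (fun y => x +i* y : Co).
Proof.
move=> y; apply/cvg_normcP => e e0.
have /cvgrPdist_lt/(_ e e0) : t @[t --> y] --> y by [].
apply: filterS => t; apply: le_lt_trans.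
by apply: le_trans (normc_le_ReIm _ _) _; rewrite subrr normr0 add0r distrC.
Qed.

End ComplexPlane.

(** * Integrals of complex-valued functions on segments *)

Section ContourIntegral.
Variable R : realType.
Local Notation C := R[i].
Local Notation Co := (R[i])^o.
Local Notation mu := (@lebesgue_measure R).
Implicit Types (a b c d x y t : R) (f g : Co -> Co).

(** Real and imaginary parts are integrated separately, as the Lebesgue integral
    takes real values. The price is the factor 2 in [normc_cint_le]. *)
Definition cint a b (phi : R -> Co) : C :=
  (\int[mu]_(t in `[a, b]) complex.Re (phi t)) +i*
  (\int[mu]_(t in `[a, b]) complex.Im (phi t)).

Definition cts_on a b (phi : R -> Co) := {within `[a, b], continuous phi}.

Lemma cts_on_Re a b phi : cts_on a b phi ->
  mu.-integrable `[a, b] (EFin \o (fun t => complex.Re (phi t))).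
Proof.
move=> h; apply: continuous_compact_integrable; first exact: segment_compact.
move=> x; exact: (@continuous_comp (subspace `[a, b]) Co R phi
  (fun z : Co => complex.Re z : R) x (h x) (@continuous_Re R _)).
Qed.

Lemma cts_on_Im a b phi : cts_on a b phi ->
  mu.-integrable `[a, b] (EFin \o (fun t => complex.Im (phi t))).
Proof.
move=> h; apply: continuous_compact_integrable; first exact: segment_compact.
move=> x; exact: (@continuous_comp (subspace `[a, b]) Co R phi
  (fun z : Co => complex.Im z : R) x (h x) (@continuous_Im R _)).
Qed.

Lemma cts_onW a b c d phi : a <= c -> d <= b -> cts_on a b phi -> cts_on c d phi.
Proof.
move=> ac db; apply: continuous_subspaceW => t /=; rewrite !in_itv /=.
by move=> /andP[ct td]; rewrite (le_trans ac ct) (le_trans td db).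
Qed.

Lemma cintD a b phi psi : cts_on a b phi -> cts_on a b psi ->
  cint a b (fun t => phi t + psi t) = cint a b phi + cint a b psi.
Proof.
move=> h1 h2; rewrite /cint; simpc; congr (_ +i* _).
  rewrite -RintegralD ?cts_on_Re//.
  by apply: eq_Rintegral => t _; rewrite raddfD.
rewrite -RintegralD ?cts_on_Im//.
by apply: eq_Rintegral => t _; rewrite raddfD.
Qed.

Lemma cintZ a b (l : C) phi : cts_on a b phi ->
  cint a b (fun t => l * phi t) = l * cint a b phi.
Proof.
move=> h; case: l => l m.
have iZ (k : R) (u : R -> R) : mu.-integrable `[a, b] (EFin \o u) ->
    mu.-integrable `[a, b] (EFin \o (fun t => k * u t)).
  by move=> ui; apply: (integrableZl _ k ui).
rewrite /cint; simpc; congr (_ +i* _).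
  rewrite -!RintegralZl ?cts_on_Re ?cts_on_Im// -RintegralB//.
  - by apply: eq_Rintegral => t _; case: (phi t).
  - by apply: iZ; exact: cts_on_Re.
  - by apply: iZ; exact: cts_on_Im.
rewrite -!RintegralZl ?cts_on_Re ?cts_on_Im// -RintegralD//.
- by apply: eq_Rintegral => t _; case: (phi t).
- by apply: iZ; exact: cts_on_Im.
- by apply: iZ; exact: cts_on_Re.
Qed.

Lemma eq_cint a b phi psi : {in `[a, b], phi =1 psi} ->
  cint a b phi = cint a b psi.
Proof.
move=> h; congr (_ +i* _); apply: eq_Rintegral => t; rewrite inE => tab.
all: by rewrite h.
Qed.

Lemma fine_lebesgue_segment a b : a <= b -> fine (mu `[a, b]%classic) = b - a.
Proof.
move=> ab; rewrite lebesgue_measure_itv /= lte_fin; case: ltP => // ba.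
by have -> : a = b by [apply: le_anti; rewrite ab]; rewrite subrr.
Qed.

Lemma cint_cst a b (l : C) : a <= b -> cint a b (fun=> l) = (b - a)%:C * l.
Proof.
move=> ab; rewrite /cint !Rintegral_cst// fine_lebesgue_segment//.
by case: l => l m; simpc; rewrite !(mulrC (b - a)).
Qed.

Lemma cint_cat a c b phi : a <= c -> c <= b -> cts_on a b phi ->
  cint a b phi = cint a c phi + cint c b phi.
Proof.
move=> ac cb h; have hc : cts_on c b phi by apply: cts_onW h.
have cat (u : R -> R) :
    mu.-integrable `[a, b] (EFin \o u) -> mu.-integrable `[c, b] (EFin \o u) ->
    \int[mu]_(t in `[a, b]) u t =
    \int[mu]_(t in `[a, c]) u t + \int[mu]_(t in `[c, b]) u t.
  move=> ui uc; rewrite -(Rintegral_itv_obnd_cbnd (r := c)); last first.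
    by apply: integrableS uc => //; exact: subset_itv_oc_cc.
  by rewrite -(Rintegral_itvB ui) ?bnd_simp// addrC subrK.
rewrite /cint; simpc; congr (_ +i* _); apply: cat.
- exact: cts_on_Re.
- exact: cts_on_Re.
- exact: cts_on_Im.
- exact: cts_on_Im.
Qed.

Lemma normr_Rintegral_le a b (u : R -> R) M : a <= b ->
  mu.-integrable `[a, b] (EFin \o u) ->
  (forall t, a <= t <= b -> `|u t| <= M) ->
  `|\int[mu]_(t in `[a, b]) u t| <= M * (b - a).
Proof.
move=> ab ui uM; apply: (le_trans (le_normr_Rintegral _ ui)) => //.
have -> : M * (b - a) = \int[mu]_(t in `[a, b]) (cst M t).
  by rewrite Rintegral_cst// fine_lebesgue_segment.
apply: le_Rintegral => //.
- exact: integrable_norm.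
- apply: continuous_compact_integrable; first exact: segment_compact.
  by move=> x; exact: cst_continuous.
Qed.

Lemma normc_cint_le a b phi M : a <= b -> cts_on a b phi ->
  (forall t, a <= t <= b -> normc (phi t) <= M) ->
  normc (cint a b phi) <= 2 * M * (b - a).
Proof.
move=> ab h hM; apply: le_trans (normc_le_ReIm _ _) _.
rewrite -mulrA mulr_natl mulr2n lerD//; apply: normr_Rintegral_le => //.
- exact: cts_on_Re.
- by move=> t /hM; apply: le_trans; exact: Re_le_normc.
- exact: cts_on_Im.
- by move=> t /hM; apply: le_trans; exact: Im_le_normc.
Qed.

End ContourIntegral.

(** * Contour integrals over rectangles *)

Section Goursat.
Variable R : realType.
Local Notation C := R[i].
Local Notation Co := (R[i])^o.
Implicit Types (a b c d x y t : R) (f g : Co -> Co).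

Lemma nested_interval (u v : nat -> R) :
  (forall n, u n <= u n.+1) -> (forall n, v n.+1 <= v n) ->
  (forall n, u n <= v n) -> exists x, forall n, u n <= x <= v n.
Proof.
move=> hu hv huv.
have um : {homo u : n m / (n <= m)%N >-> n <= m} by exact: homo_leq le_trans hu.
have vm : {homo v : n m / (n <= m)%N >-> m <= n}.
  by apply: homo_leq => // y x z xy yz; exact: le_trans yz xy.
have uv n m : u n <= v m.
  have [nm|/ltnW mn] := leqP n m; first exact: le_trans (um _ _ nm) (huv m).
  exact: le_trans (huv n) (vm _ _ mn).
exists (sup (range u)) => n; apply/andP; split.
  by apply: ub_le_sup; [exists (v 0%N) => _ [m _ <-]|exists n].
by apply: ge_sup => [|_ [m _ <-]//]; exists (u 0%N), 0%N.
Qed.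

Lemma geometric_small (w e : R) : 0 < e -> exists n : nat, w / 2 ^+ n < e.
Proof.
move=> e0; pose n := Num.bound `|w / e|; exists n.
have h : `|w / e| < n%:R by apply: archi_boundP.
rewrite ltr_pdivrMr ?exprn_gt0// mulrC -ltr_pdivrMr//.
apply: le_lt_trans (ler_norm _) _; apply: lt_trans h _.
by rewrite -natrX ltr_nat ltn_expl.
Qed.

(** If [P] failed for a rectangle, it would fail for one of its quarters, and so
    on down to a point, where the local hypothesis contradicts this. *)
Lemma rectangle_bisection (P : R -> R -> R -> R -> Prop) a b c d :
  a <= b -> c <= d ->
  (forall a b c d, a <= b -> c <= d ->
    let m := (a + b) / 2 in let n := (c + d) / 2 in
    P a m c n -> P m b c n -> P a m n d -> P m b n d -> P a b c d) ->
  (forall x y, a <= x <= b -> c <= y <= d -> exists2 e, 0 < e &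
    forall a' b' c' d', a' <= x <= b' -> c' <= y <= d' ->
      b' - a' < e -> d' - c' < e -> P a' b' c' d') ->
  P a b c d.
Proof.
move=> ab cd hsplit hloc; apply: contrapT => nP.
pose T := (R * R * R * R)%type.
pose valid (r : T) := r.1.1.1 <= r.1.1.2 /\ r.1.2 <= r.2.
pose bad (r : T) := valid r /\ ~ P r.1.1.1 r.1.1.2 r.1.2 r.2.
pose half (r s : T) := [/\ r.1.1.1 <= s.1.1.1 & s.1.1.2 <= r.1.1.2] /\
  [/\ r.1.2 <= s.1.2, s.2 <= r.2,
      s.1.1.2 - s.1.1.1 = (r.1.1.2 - r.1.1.1) / 2 &
      s.2 - s.1.2 = (r.2 - r.1.2) / 2].
have step (r : T) : exists s, bad r -> bad s /\ half r s.
  have [[[rv1 rv2] nPr]|nb] := pselect (bad r); last by exists r.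
  case: r rv1 rv2 nPr => -[[a1 b1] c1] d1 /= ab1 cd1 nP1.
  set m := (a1 + b1) / 2; set n := (c1 + d1) / 2.
  apply: contrapT => /forallNP ns; apply: nP1.
  have key s : half (a1, b1, c1, d1) s -> valid s ->
      P s.1.1.1 s.1.1.2 s.1.2 s.2.
    move=> hs vs; apply: contrapT => nPs; apply: (ns s) => _; split => //.
  apply: hsplit => //; rewrite -/m -/n;
    [apply: (key (a1, m, c1, n))|apply: (key (m, b1, c1, n))|
     apply: (key (a1, m, n, d1))|apply: (key (m, b1, n, d1))];
    rewrite /half /valid /= /m /n; do ?split; lra.
have [s sP] := choice step.
pose u n := iter n s (a, b, c, d).
have ubad n : bad (u n).
  elim: n => [|n IH]; first by split.
  by have [] := sP _ IH.
have uhalf n : half (u n) (u n.+1) by have [] := sP _ (ubad n).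
have [x hx] : exists x, forall n, (u n).1.1.1 <= x <= (u n).1.1.2.
  apply: nested_interval => n.
  - by have [[]] := uhalf n.
  - by have [[]] := uhalf n.
  - by have [[]] := ubad n.
have [y hy] : exists y, forall n, (u n).1.2 <= y <= (u n).2.
  apply: nested_interval => n.
  - by have [_ []] := uhalf n.
  - by have [_ []] := uhalf n.
  - by have [[]] := ubad n.
have wx n : (u n).1.1.2 - (u n).1.1.1 = (b - a) / 2 ^+ n.
  elim: n => [|n IH]; first by rewrite expr0 divr1.
  by have [_ [_ _ -> _]] := uhalf n; rewrite IH exprSr invfM mulrA.
have wy n : (u n).2 - (u n).1.2 = (d - c) / 2 ^+ n.
  elim: n => [|n IH]; first by rewrite expr0 divr1.
  by have [_ [_ _ _ ->]] := uhalf n; rewrite IH exprSr invfM mulrA.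
have [e e0 eP] := hloc x y (hx 0%N) (hy 0%N).
have [n nP'] := geometric_small ((b - a) + (d - c)) e0.
have [_] := ubad n; apply; apply: eP => //; rewrite ?wx ?wy; apply: le_lt_trans nP'.
  by rewrite ler_pM2r ?invr_gt0 ?exprn_gt0//; lra.
by rewrite ler_pM2r ?invr_gt0 ?exprn_gt0//; lra.
Qed.

(** The boundary of the rectangle is run through counterclockwise. *)
Definition crect f a b c d : C :=
  cint a b (fun x => f (x +i* c)) - cint a b (fun x => f (x +i* d)) +
  'i * (cint c d (fun y => f (b +i* y)) - cint c d (fun y => f (a +i* y))).

Lemma cts_hline f a b y : continuous f -> cts_on a b (fun x => f (x +i* y)).
Proof.
move=> fc; apply: continuous_subspaceT => x.
exact: continuous_comp (@continuous_hline R y x) (fc _).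
Qed.

Lemma cts_vline f a b x : continuous f -> cts_on a b (fun y => f (x +i* y)).
Proof.
move=> fc; apply: continuous_subspaceT => y.
exact: continuous_comp (@continuous_vline R x y) (fc _).
Qed.

Arguments cts_hline [f] a b y _ _.
Arguments cts_vline [f] a b x _ _.

Lemma crect_splitx f a m b c d : continuous f -> a <= m -> m <= b ->
  crect f a b c d = crect f a m c d + crect f m b c d.
Proof.
move=> fc am mb; rewrite /crect.
rewrite (cint_cat am mb (cts_hline a b c fc)) (cint_cat am mb (cts_hline a b d fc)).
by ring.
Qed.

Lemma crect_splity f a b c m d : continuous f -> c <= m -> m <= d ->
  crect f a b c d = crect f a b c m + crect f a b m d.
Proof.
move=> fc cm md; rewrite /crect.
rewrite (cint_cat cm md (cts_vline c d a fc)) (cint_cat cm md (cts_vline c d b fc)).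
by ring.
Qed.

Lemma crectD f g a b c d : continuous f -> continuous g ->
  crect (fun z => f z + g z) a b c d = crect f a b c d + crect g a b c d.
Proof.
move=> fc gc; rewrite /crect.
rewrite (cintD (cts_hline a b c fc) (cts_hline a b c gc)).
rewrite (cintD (cts_hline a b d fc) (cts_hline a b d gc)).
rewrite (cintD (cts_vline c d a fc) (cts_vline c d a gc)).
rewrite (cintD (cts_vline c d b fc) (cts_vline c d b gc)).
by ring.
Qed.

Lemma crectZ (l : C) f a b c d : continuous f ->
  crect (fun z => l * f z) a b c d = l * crect f a b c d.
Proof.
move=> fc; rewrite /crect.
rewrite (cintZ l (cts_hline a b c fc)) (cintZ l (cts_hline a b d fc)).
rewrite (cintZ l (cts_vline c d a fc)) (cintZ l (cts_vline c d b fc)).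
by ring.
Qed.

Lemma crect_cst (u : C) a b c d : a <= b -> c <= d -> crect (fun=> u) a b c d = 0.
Proof. by move=> ab cd; rewrite /crect !cint_cst// !subrr mulr0 addr0. Qed.

(** On opposite sides the identity takes values that differ by a constant, so
    that the integrals of constants suffice. *)
Lemma crect_id a b c d : a <= b -> c <= d -> crect id a b c d = 0.
Proof.
move=> ab cd; have ic : continuous (@id Co) by move=> z.
have diffE u v phi psi (k : C) : u <= v -> cts_on u v phi ->
    (forall t, psi t = phi t + k) ->
    cint u v psi - cint u v phi = (v - u)%:C * k.
  move=> uv pc h; rewrite (eq_cint (psi := fun t => phi t + k)) => [|t _]; last exact: h.
  have kc : cts_on u v (fun=> k : Co).
    by apply: continuous_subspaceT => x; exact: cst_continuous.
  by rewrite (cintD pc kc) cint_cst// addrAC subrr add0r.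
rewrite /crect (@diffE _ _ _ _ ('i * (c - d)%:C) ab (cts_hline a b d ic)); last first.
  by move=> t; simpc; rewrite addrC subrK.
rewrite (@diffE _ _ _ _ ((b - a)%:C) cd (cts_vline c d a ic)); last first.
  by move=> t; simpc; rewrite addrC subrK.
by rewrite -(opprB c d) rmorphN; ring.
Qed.

Lemma crect_affine (u v : C) a b c d : a <= b -> c <= d ->
  crect (fun z => u + v * z) a b c d = 0.
Proof.
move=> ab cd; have ic : continuous (@id Co) by move=> z.
have vc : continuous ((fun z => v * z) : Co -> Co).
  by move=> z; exact: (@mulrl_continuous _ v z).
have uc : continuous ((fun=> u) : Co -> Co) by exact: (@cst_continuous Co Co u).
have := crectD a b c d uc vc; rewrite crect_cst// add0r => ->.
by have := crectZ v a b c d ic; rewrite crect_id// mulr0.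
Qed.

Lemma normc_crect_le f a b c d M : continuous f -> a <= b -> c <= d ->
  (forall x y, a <= x <= b -> c <= y <= d ->
    [|| x == a, x == b, y == c | y == d] -> normc (f (x +i* y)) <= M) ->
  normc (crect f a b c d) <= 4 * M * ((b - a) + (d - c)).
Proof.
move=> fc ab cd hM.
have h1 y : (y == c) || (y == d) ->
    normc (cint a b (fun x => f (x +i* y))) <= 2 * M * (b - a).
  move=> ycd; apply: normc_cint_le => //; first exact: cts_hline.
  move=> t tab; apply: hM => //; last by rewrite ycd !orbT.
  by case/orP: ycd => /eqP ->; rewrite lexx cd.
have h2 x : (x == a) || (x == b) ->
    normc (cint c d (fun y => f (x +i* y))) <= 2 * M * (d - c).
  move=> xab; apply: normc_cint_le => //; first exact: cts_vline.
  move=> t tcd; apply: hM => //; last by case/orP: xab => ->; rewrite ?orbT.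
  by case/orP: xab => /eqP ->; rewrite lexx ab.
have ni : normc ('i : C) = 1 by rewrite /= expr0n expr1n add0r sqrtr1.
apply: le_trans (ler_normcD _ _) _; rewrite normcM ni mul1r.
have := lerD (le_trans (ler_normcB _ _) (lerD (h1 c _) (h1 d _)))
             (le_trans (ler_normcB _ _) (lerD (h2 b _) (h2 a _))).
rewrite !eqxx !orbT => /(_ isT isT isT isT) /le_trans; apply; lra.
Qed.
End Goursat.

(** * Goursat's lemma and Liouville's theorem *)

Section Liouville.
Variable R : realType.
Local Notation C := R[i].
Local Notation Co := (R[i])^o.
Implicit Types (a b c d x y t : R) (f g h : Co -> Co).

Lemma differentiable_normc f (z : Co) : differentiable f z ->
  exists l : C, forall e, 0 < e -> exists2 r, 0 < r & forall w,
    normc (w - z) < r -> normc (f w - f z - l * (w - z)) <= e * normc (w - z).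
Proof.
move/derivable1_diffP => /cvg_ex[/= l hl]; exists l => e e0.
have /cvg_normcP/(_ e e0) := hl; rewrite near_withinE => /nbhs_normcP[r r0 hr].
exists r => // w wr; have [->|wz] := eqVneq w z.
  by rewrite !subrr mulr0 subr0 normc0 mulr0.
have wz0 : w - z != 0 by rewrite subr_eq0.
have := hr (w - z); rewrite subr0 => /(_ wr wz0) /ltW.
have -> : f w - f z - l * (w - z) =
    ((w - z)^-1 *: (f ((w - z) *: 1 + z) - f z) - l) * (w - z).
  rewrite mulrBl; congr (_ - _).
  have -> : (w - z) *: (1 : Co) + z = w by rewrite /GRing.scale /= mulr1 subrK.
  by rewrite /GRing.scale /= mulrAC mulVf ?mul1r.
by rewrite normcM => he; rewrite ler_wpM2r ?normc_ge0.
Qed.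

Lemma midpoint_le a b : a <= b -> a <= (a + b) / 2 /\ (a + b) / 2 <= b.
Proof. by move=> ab; split; lra. Qed.

(** Bisection localises a non-zero contour integral at a point, where the
    function is affine up to an error that is small relative to the area. *)
Lemma goursat f a b c d : continuous f -> a <= b -> c <= d ->
  (forall x y, a <= x <= b -> c <= y <= d -> differentiable f (x +i* y : Co)) ->
  crect f a b c d = 0.
Proof.
move=> fc ab cd fd; apply: eq0_normc; apply/eqP; rewrite eq_le normc_ge0 andbT.
pose D := (b - a) + (d - c).
suff H e : 0 < e -> normc (crect f a b c d) <= e * D ^+ 2.
  apply/ler_addgt0Pr => e e0; rewrite add0r.
  have D0 : 0 < D ^+ 2 + 1 by rewrite ltr_wpDl ?sqr_ge0.
  apply: le_trans (H (e / (D ^+ 2 + 1)) (divr_gt0 e0 D0)) _.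
  by rewrite mulrAC ler_pdivrMr// ler_pM2l// lerDl.
move=> e0; rewrite /D.
apply: (@rectangle_bisection R (fun a b c d =>
  normc (crect f a b c d) <= e * ((b - a) + (d - c)) ^+ 2)) => //.
  move=> a1 b1 c1 d1 ab1 cd1 m n h1 h2 h3 h4.
  have [am mb] := midpoint_le ab1.
  have [cn nd] := midpoint_le cd1.
  rewrite (crect_splitx _ _ fc am mb) (crect_splity _ _ fc cn nd).
  rewrite (crect_splity m b1 fc cn nd).
  apply: le_trans (ler_normcD _ _) _.
  apply: le_trans (lerD (ler_normcD _ _) (ler_normcD _ _)) _.
  apply: le_trans (lerD (lerD h1 h3) (lerD h2 h4)) _.
  by rewrite /m /n; lra.
move=> x y xab ycd.
have [l hl] := differentiable_normc (fd x y xab ycd).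
have [r r0 hr] := hl (e / 4) (divr_gt0 e0 (ltr0n _ 4)).
exists (r / 2); first by rewrite divr_gt0.
move=> a1 b1 c1 d1 /andP[ax xb] /andP[cy yd] wab wcd.
pose z := x +i* y; pose u := f z - l * z.
pose g (w : Co) : Co := f w - (u + l * w).
have ac : continuous ((fun w => u + l * w) : Co -> Co).
  move=> w; apply: (@continuousD _ Co Co (cst u) (fun w => l * w)).
    exact: cst_continuous.
  exact: (@mulrl_continuous _ l w).
have gc : continuous g by move=> w; apply: continuousB; [exact: fc|exact: ac].
have fE : f = (fun w => g w + (u + l * w)).
  by apply/funext => w; rewrite /g subrK.
have -> : crect f a1 b1 c1 d1 = crect g a1 b1 c1 d1.
  have ab1 : a1 <= b1 by lra.
  have cd1 : c1 <= d1 by lra.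
  have := crectD a1 b1 c1 d1 gc ac; rewrite crect_affine// addr0 => <-.
  by rewrite {1}fE.
have D0 : 0 <= (b1 - a1) + (d1 - c1) by lra.
rewrite expr2 mulrA.
have -> : e * (b1 - a1 + (d1 - c1)) = 4 * (e / 4 * (b1 - a1 + (d1 - c1))) by lra.
apply: normc_crect_le => //; try lra.
move=> s t /andP[as_ sb] /andP[ct td] _.
have wz : normc ((s +i* t) - z) <= (b1 - a1) + (d1 - c1).
  apply: le_trans (normc_le_ReIm _ _) _.
  by rewrite lerD// ler_norml; apply/andP; split; lra.
have -> : g (s +i* t) = f (s +i* t) - f z - l * ((s +i* t) - z).
  by rewrite /g /u mulrBr !opprD !opprK !addrA addrAC -!addrA; congr (_ + _); ring.
apply: le_trans (hr _ _) _; first by apply: le_lt_trans wz _; lra.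
by rewrite ler_pM2l// divr_gt0.
Qed.

(** Around [p] a small square is cut out. The function has no singularity on the
    four remaining rectangles, and it is bounded on the square, the perimeter of
    which tends to 0. *)
Lemma goursat_punctured f (p : C) a b c d :
  a < complex.Re p < b -> c < complex.Im p < d -> continuous f ->
  (forall z : Co, z != p -> differentiable f z) -> crect f a b c d = 0.
Proof.
case: p => x y /= /andP[ax xb] /andP[cy yd] fc fd.
apply: eq0_normc; apply/eqP; rewrite eq_le normc_ge0 andbT.
pose M := normc (f (x +i* y)) + 1.
have M0 : 0 < M by rewrite ltr_wpDl ?normc_ge0.
have [r r0 hr] : exists2 r, 0 < r & forall w, normc (w - x +i* y) < r ->
    normc (f w) <= M.
  have /cvg_normcP/(_ 1 ltr01) /nbhs_normcP[r r0 hr] := fc (x +i* y).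
  exists r => // w /hr /= fw; rewrite -[f w](subrK (f (x +i* y))) /M.
  by apply: le_trans (ler_normcD _ _) _; rewrite addrC lerD2l ltW.
apply/ler_addgt0Pr => e e0; rewrite add0r.
have [t t0 [ta tb tc td [tr te]]] : exists2 t, 0 < t &
    [/\ t <= x - a, t <= b - x, t <= y - c, t <= d - y & 2 * t < r /\ t <= e / (16 * M)].
  have e1 : 0 < e / (16 * M) by rewrite divr_gt0// mulr_gt0.
  exists (Num.min (Num.min (Num.min (x - a) (b - x)) (Num.min (y - c) (d - y)))
                  (Num.min (r / 3) (e / (16 * M)))).
    by rewrite !lt_min !subr_gt0 ax xb cy yd e1 divr_gt0.
  set m := Num.min _ _.
  have : m <= m by [].
  rewrite {2}/m !le_min -!andbA.
  move=> /andP[-> /andP[-> /andP[-> /andP[-> /andP[mr ->]]]]].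
  by split => //; split => //; lra.
have z0 a' b' c' d' : a' <= b' -> c' <= d' ->
    [|| b' < x, x < a', d' < y | y < c'] -> crect f a' b' c' d' = 0.
  move=> ab' cd' hne; apply: (goursat fc ab' cd') => s u /andP[as_ sb] /andP[cu ud].
  apply: fd; apply/eqP => -[sx uy]; move: hne; rewrite -sx -uy.
  by rewrite !ltNge as_ sb cu ud.
have h1 : a <= x - t by lra.
have h2 : x - t <= x + t by lra.
have h3 : x + t <= b by lra.
have h4 : c <= y - t by lra.
have h5 : y - t <= y + t by lra.
have h6 : y + t <= d by lra.
rewrite (crect_splitx c d fc h1 (le_trans h2 h3)) (crect_splitx c d fc h2 h3).
rewrite (crect_splity (x - t) (x + t) fc h4 (le_trans h5 h6)).
rewrite (crect_splity (x - t) (x + t) fc h5 h6).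
have xt : x - t < x by lra.
have tx : x < x + t by lra.
have yt : y - t < y by lra.
have ty : y < y + t by lra.
have cd : c <= d by lra.
rewrite (z0 a) ?xt// (z0 (x + t)) ?tx ?orbT// (z0 _ _ c) ?yt ?orbT//.
rewrite (z0 _ _ (y + t)) ?ty ?orbT//.
rewrite !(add0r, addr0).
apply: le_trans (@normc_crect_le R f _ _ _ _ M fc h2 h5 _) _.
  move=> s u /andP[? ?] /andP[? ?] _; apply: hr; apply: le_lt_trans tr.
  apply: le_trans (normc_le_ReIm _ _) _; rewrite mulr_natl mulr2n.
  by rewrite lerD// ler_norml; apply/andP; split; lra.
have : t * (16 * M) <= e by rewrite -ler_pdivlMr// mulr_gt0.
lra.
Qed.

(** At [p] the quotient is extended by the derivative. The extension is
    continuous, which is what [goursat_punctured] asks for at [p]. *)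
Lemma difference_quotient h (p : Co) : (forall z, differentiable h z) ->
  exists g, [/\ continuous g, (forall z, z != p -> differentiable g z) &
    forall z, z != p -> g z = (h z - h p) / (z - p)].
Proof.
move=> hd; have idd z : differentiable (id : Co -> Co) z.
  by apply/derivable1_diffP; exact: derivable_id.
have [l hl] := differentiable_normc (hd p).
pose q : Co -> Co := (fun z => h z - h p) * (fun z => (z - p)^-1).
pose g (z : Co) : Co := if z == p then l else q z.
have gq z : z != p -> \near z, g z = q z.
  move=> zp; apply/nbhs_normcP; exists (normc (z - p)).
    by rewrite normc_gt0// subr_eq0.
  move=> w wz; rewrite /g; case: eqP => // wp.
  by move: wz; rewrite wp normcC ltxx.
have qd z : z != p -> differentiable q z.
  move=> zp; apply: differentiableM.
    by apply: differentiableB; [exact: hd|exact: differentiable_cst].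
  apply: differentiableV; last by rewrite subr_eq0.
  by apply: differentiableB; [exact: idd|exact: differentiable_cst].
have gd z : z != p -> differentiable g z.
  move=> zp; apply/derivable1_diffP.
  apply: (@near_eq_derivable _ Co Co q g z 1).
    by apply: filterS (gq z zp) => w ->.
  by apply/derivable1_diffP; exact: qd.
exists g; split=> //; last by move=> z zp; rewrite /g (negbTE zp).
move=> z; have [->{z}|zp] := eqVneq z p; last first.
  exact: differentiable_continuous (gd z zp).
apply/(cvg_normcP (nbhs_filter p)) => e e0.
have e20 : 0 < e / 2 by rewrite divr_gt0.
have [r r0 hr] := hl _ e20; apply/nbhs_normcP; exists r => // w wr.
have -> : g p = l by rewrite /g eqxx.
rewrite /g; case: eqVneq => [_|wp]; first by rewrite subrr normc0.
have wp0 : w - p != 0 by rewrite subr_eq0.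
have -> : q w - l = (h w - h p - l * (w - p)) / (w - p).
  by rewrite mulrBl mulfK.
rewrite normcM normcV ltr_pdivrMr ?normc_gt0//.
apply: le_lt_trans (hr w wr) _.
by rewrite ltr_pM2r ?normc_gt0// ltr_pdivrMr// ltr_pMr// ltr1n.
Qed.

Lemma continuous_complex (T : topologicalType) (u v : T -> R) :
  continuous u -> continuous v -> continuous (fun s => u s +i* v s : Co).
Proof.
move=> uc vc s; apply/(cvg_normcP (nbhs_filter s)) => e e0.
have e20 : 0 < e / 2 by rewrite divr_gt0.
have /cvgrPdist_lt/(_ _ e20) hu := uc s.
have /cvgrPdist_lt/(_ _ e20) hv := vc s.
apply: filterS2 hu hv => w us vs; apply: le_lt_trans (normc_le_ReIm _ _) _.
by rewrite (splitr e) ltrD// distrC.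
Qed.

(** A continuous function on the whole plane that agrees with the inverse
    outside the disc of radius [r]. *)
Definition tame_inv (r : R) (z : Co) : Co :=
  let m := (Num.max (complex.Re z ^+ 2 + complex.Im z ^+ 2) (r ^+ 2))^-1 in
  (complex.Re z * m) +i* (- (complex.Im z * m)).

Lemma tame_invE (r : R) z : 0 < r -> r <= normc z -> tame_inv r z = z^-1.
Proof.
case: z => x y r0; rewrite -(ler_pXn2r (_ : (0 < 2)%N)) ?nnegrE ?(ltW r0) ?normc_ge0//.
by rewrite /= sqr_sqrtr ?addr_ge0 ?sqr_ge0// /tame_inv /= => /max_l ->.
Qed.

Lemma continuous_tame_inv (r : R) : 0 < r -> continuous (tame_inv r).
Proof.
move=> r0; have mc : continuous (fun z : Co =>
    (Num.max (complex.Re z ^+ 2 + complex.Im z ^+ 2) (r ^+ 2))^-1 : R).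
  move=> z; apply: (@cvgV R _ _ (nbhs_filter z)).
    by rewrite gt_eqF// lt_max exprn_gt0 ?orbT.
  apply: (@continuous_max R Co); last exact: (@cst_continuous Co R (r ^+ 2) z).
  have sq (w : Co -> R) : continuous w -> {for z, continuous (fun z => w z ^+ 2)}.
    by move=> wc; exact: (@continuousM R Co w w z (wc z) (wc z)).
  exact: (@continuousD _ R^o Co (fun z => complex.Re z ^+ 2)
    (fun z => complex.Im z ^+ 2) z (sq _ (@continuous_Re R)) (sq _ (@continuous_Im R))).
apply: continuous_complex => z.
  by apply: (@continuousM R Co); [exact: continuous_Re|exact: mc].
apply: (@continuousN R R Co).
by apply: (@continuousM R Co); [exact: continuous_Im|exact: mc].
Qed.

Lemma segment_cst_integrable a b (k : R) :
  (@lebesgue_measure R).-integrable `[a, b] (EFin \o cst k).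
Proof.
apply: continuous_compact_integrable; first exact: segment_compact.
by move=> x; exact: cst_continuous.
Qed.

Lemma Rintegral_ge a b (u : R -> R) m : a <= b ->
  (@lebesgue_measure R).-integrable `[a, b] (EFin \o u) ->
  (forall t, a <= t <= b -> m <= u t) ->
  m * (b - a) <= \int[@lebesgue_measure R]_(t in `[a, b]) u t.
Proof.
move=> ab ui um; rewrite -(fine_lebesgue_segment ab) -Rintegral_cst//.
by apply: le_Rintegral => //; exact: segment_cst_integrable.
Qed.

Lemma Rintegral_le a b (u : R -> R) M : a <= b ->
  (@lebesgue_measure R).-integrable `[a, b] (EFin \o u) ->
  (forall t, a <= t <= b -> u t <= M) ->
  \int[@lebesgue_measure R]_(t in `[a, b]) u t <= M * (b - a).
Proof.
move=> ab ui um; rewrite -(fine_lebesgue_segment ab) -Rintegral_cst//.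
by apply: le_Rintegral => //; exact: segment_cst_integrable.
Qed.

(** This is the integral of 1/z over the boundary of a square centred at 0. Each
    of the four sides contributes at least 1 to its imaginary part. *)
Lemma Im_crect_tame_inv (r : R) : 0 < r ->
  4 <= complex.Im (crect (tame_inv r) (- r) r (- r) r).
Proof.
move=> r0; have c := continuous_tame_inv r0.
have rr : - r <= r by lra.
have m0 x : - r <= x <= r -> (2 * r)^-1 <= r / (x ^+ 2 + r ^+ 2).
  move=> /andP[x1 x2]; have x3 : x ^+ 2 <= r ^+ 2.
    by rewrite -ler_sqrt ?sqr_ge0// !sqrtr_sqr (gtr0_norm r0) ler_norml x1.
  rewrite ler_pdivlMr; last by rewrite ltr_wpDl ?sqr_ge0 ?exprn_gt0.
  rewrite mulrC ler_pdivrMr ?mulr_gt0//; nra.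
have mx x : Num.max (x ^+ 2 + r ^+ 2) (r ^+ 2) = x ^+ 2 + r ^+ 2.
  by apply: max_l; rewrite lerDr sqr_ge0.
have one : (2 * r)^-1 * (r - - r) = 1 by field; rewrite gt_eqF.
have iE (w1 w2 : C) : complex.Im (w1 + 'i * w2) = complex.Im w1 + complex.Re w2.
  by case: w1 w2 => ? ? [? ?]; rewrite /=; ring.
have Nm0 x : - r <= x <= r -> - (r / (x ^+ 2 + r ^+ 2)) <= - (2 * r)^-1.
  by move=> xr; rewrite lerN2 m0.
have i1 : 1 <= complex.Im (cint (- r) r (fun x => tame_inv r (x +i* - r))).
  rewrite -one; apply: Rintegral_ge => //; first exact/cts_on_Im/cts_hline.
  by move=> x /m0; rewrite /tame_inv /= sqrrN mx mulNr opprK.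
have i2 : complex.Im (cint (- r) r (fun x => tame_inv r (x +i* r))) <= - 1.
  rewrite -one -mulNr; apply: Rintegral_le => //; first exact/cts_on_Im/cts_hline.
  by move=> x /Nm0; rewrite /tame_inv /= mx.
have i3 : 1 <= complex.Re (cint (- r) r (fun y => tame_inv r (r +i* y))).
  rewrite -one; apply: Rintegral_ge => //; first exact/cts_on_Re/cts_vline.
  by move=> x /m0; rewrite /tame_inv /= [r ^+ 2 + _]addrC mx.
have i4 : complex.Re (cint (- r) r (fun y => tame_inv r (- r +i* y))) <= - 1.
  rewrite -one -mulNr; apply: Rintegral_le => //; first exact/cts_on_Re/cts_vline.
  by move=> x /Nm0; rewrite /tame_inv /= sqrrN [r ^+ 2 + _]addrC mx mulNr.
have imB (w1 w2 : C) : complex.Im (w1 - w2) = complex.Im w1 - complex.Im w2.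
  exact: raddfB.
have reB (w1 w2 : C) : complex.Re (w1 - w2) = complex.Re w1 - complex.Re w2.
  exact: raddfB.
rewrite /crect iE imB reB; lra.
Qed.

(** Over a large square of half-side [r], the difference quotients of [h] at 0
    and at [z1] both have integral 0, by [goursat_punctured]. Their difference is
    (h z1 - h 0) / z up to a term of order r^-2, whose integral is of order r^-1,
    whereas the integral of 1/z stays away from 0. *)
Theorem liouville h (M : R) : (forall z, differentiable h z) ->
  (forall z, normc (h z) <= M) -> forall z, h z = h 0.
Proof.
move=> hd hM z1; apply/eqP; rewrite -subr_eq0; apply/eqP/eq0_normc.
have M0 : 0 <= M := le_trans (normc_ge0 _) (hM 0).
set k := h z1 - h 0; pose A := normc z1.
have A0 : 0 <= A := normc_ge0 _.
(* This quantitative form gives k = 0 when r tends to infinity. *)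
suff key (r : R) : A < r -> normc k * (r - A) <= 8 * M * A.
  apply/eqP; rewrite eq_le normc_ge0 andbT leNgt; apply/negP => k0.
  have := key (A + (8 * M * A + 1) / normc k).
  have e0 : 0 < 8 * M * A + 1 by rewrite ltr_wpDl ?mulr_ge0.
  rewrite ltrDl divr_gt0// => /(_ isT).
  by rewrite addrAC subrr add0r mulrC divfK ?gt_eqF//; lra.
move=> Ar; have r0 : 0 < r := le_lt_trans A0 Ar.
have rr : - r <= r by lra.
have [g0 [g0c g0d g0E]] := difference_quotient 0 hd.
have [g1 [g1c g1d g1E]] := difference_quotient z1 hd.
have in0 (p : C) : normc p < r -> (- r < complex.Re p < r) && (- r < complex.Im p < r).
  move=> pr; have := Re_le_normc p; have := Im_le_normc p.
  by rewrite !ler_norml => /andP[? ?] /andP[? ?]; rewrite -!andbA; apply/and4P; split; lra.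
have /andP[re0 im0] := in0 0 (eq_ind_r (fun x => x < r) r0 (normc0 R)).
have /andP[re1 im1] := in0 z1 Ar.
have E0 : crect g0 (- r) r (- r) r = 0 by exact: (goursat_punctured re0 im0).
have E1 : crect g1 (- r) r (- r) r = 0 by exact: (goursat_punctured re1 im1).
pose kap := tame_inv r; have kc : continuous kap := continuous_tame_inv r0.
pose e (z : Co) : Co := g0 z + (-1) * g1 z.
have mc (l : C) (f : Co -> Co) : continuous f -> continuous ((fun z => l * f z) : Co -> Co).
  by move=> fc z; exact: (@continuousM _ Co (cst l) f z (@cst_continuous Co Co l z) (fc z)).
have ec : continuous e by move=> z; exact: (@continuousD _ Co Co _ _ z (g0c z) (mc _ _ g1c z)).
have Ee : crect e (- r) r (- r) r = 0.
  by rewrite /e (crectD _ _ _ _ g0c (mc _ _ g1c)) (crectZ _ _ _ _ _ g1c) E0 E1 mulr0 addr0.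
pose rem (z : Co) : Co := e z + (- k) * kap z.
have rc : continuous rem by move=> z; exact: (@continuousD _ Co Co _ _ z (ec z) (mc _ _ kc z)).
have Erem : crect rem (- r) r (- r) r = - k * crect kap (- r) r (- r) r.
  by rewrite /rem (crectD _ _ _ _ ec (mc _ _ kc)) (crectZ _ _ _ _ _ kc) Ee add0r.
have rem_le x y : - r <= x <= r -> - r <= y <= r ->
    [|| x == - r, x == r, y == - r | y == r] ->
    normc (rem (x +i* y)) <= 2 * M * A / (r * (r - A)).
  move=> xr yr bd; set z : C := x +i* y.
  have rz : r <= normc z.
    case/or4P: bd => /eqP h0; [apply: le_trans (Re_le_normc z)|apply: le_trans (Re_le_normc z)|
      apply: le_trans (Im_le_normc z)|apply: le_trans (Im_le_normc z)];
    by rewrite /= h0 ?normrN ler_norm.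
  have z0 : z != 0 by apply: contraTneq rz => ->; rewrite normc0 -ltNge.
  have z10 : z - z1 != 0.
    by rewrite subr_eq0; apply: contraTneq rz => ->; rewrite -ltNge.
  have zz1 : z != z1 by rewrite -subr_eq0.
  have -> : rem z = (h z1 - h z) * z1 / (z * (z - z1)).
    rewrite /rem /e g0E// g1E// /kap tame_invE// /k subr0.
    by move: z10 z0; move: (h z) (h z1) (h 0) => u v w z10 z0; field; rewrite z10.
  have zn : r - A <= normc (z - z1).
    apply: le_trans (_ : normc z - normc (- z1) <= _); last exact: ler_subnormc.
    by rewrite normcNE lerB.
  rewrite !normcM normcV normcM.
  have rA : 0 < r - A by rewrite subr_gt0.
  apply: ler_pM; rewrite ?invr_ge0 ?mulr_ge0 ?normc_ge0 //.
    apply: ler_pM; rewrite ?normc_ge0 //; apply: le_trans (ler_normcB _ _) _.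
    by rewrite mulr_natl mulr2n lerD.
  rewrite lef_pV2 ?posrE ?mulr_gt0//; last 2 first.
  - by apply: lt_le_trans rz.
  - by apply: lt_le_trans zn.
  by apply: ler_pM => //; apply: ltW.
have := @normc_crect_le R rem _ _ _ _ _ rc rr rr rem_le.
rewrite Erem normcM normcNE => kle.
have k4 : 4 * normc k <= normc k * normc (crect kap (- r) r (- r) r).
  rewrite mulrC ler_wpM2l ?normc_ge0//.
  apply: le_trans (Im_crect_tame_inv r0) _.
  exact: le_trans (ler_norm _) (Im_le_normc _).
have := le_trans k4 kle.
have -> : 4 * (2 * M * A / (r * (r - A))) * (r - - r + (r - - r)) = 4 * (8 * M * A) / (r - A).
  by field; rewrite !gt_eqF// subr_gt0.
by rewrite ler_pdivlMr ?subr_gt0// -!mulrA ler_pM2l// !mulrA.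
Qed.

End Liouville.

(** * The complex exponential *)

Section ComplexExponential.
Variable R : realType.
Local Notation C := R[i].
Local Notation Co := (R[i])^o.
Implicit Types (z w : C) (x y : R).

Lemma cexpD z w : cexp (z + w) = cexp z * cexp w.
Proof.
case: z w => [a b] [c d]; rewrite /cexp /= expRD cosD sinD; simpc.
by congr (_ +i* _); ring.
Qed.

Lemma cexp0 : cexp (0 : C) = 1.
Proof. by rewrite /cexp /= expR0 cos0 sin0; simpc. Qed.

Lemma cexpN z : cexp (- z) = (cexp z)^-1.
Proof.
apply: (mulIf (cexp_neq0 z)); rewrite mulVf ?cexp_neq0//.
by rewrite -cexpD addNr cexp0.
Qed.

Lemma cexp_natmul z n : cexp (z *+ n) = cexp z ^+ n.
Proof.
elim: n => [|n IH]; first by rewrite mulr0n cexp0.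
by rewrite mulrS cexpD IH exprS.
Qed.

Lemma cexp_intmul z (n : int) : cexp (z *~ n) = cexp z ^ n.
Proof.
case: n => n; first exact: cexp_natmul.
by rewrite NegzE mulrNz cexpN cexp_natmul exprnN.
Qed.

Lemma normc_cexp z : normc (cexp z) = expR (complex.Re z).
Proof.
rewrite /cexp normcM normc_real (ger0_norm (expR_ge0 _)) /= cos2Dsin2 sqrtr1.
by rewrite mulr1.
Qed.

Lemma derive_littleo (f : R -> R) (l : R) : is_derive (0 : R) 1 f l ->
  forall e, 0 < e -> \forall h \near (0 : R), `|f h - f 0 - l * h| <= e * `|h|.
Proof.
move=> [/cvg_ex[/= m hm] <-] e e0.
have -> : 'D_1 f 0 = m by exact/cvg_lim/hm.
have /cvgrPdist_le/(_ _ e0) := hm; rewrite near_withinE.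
apply: filterS => h; have [-> _|h0 /(_ isT)] := eqVneq h 0.
  by rewrite subrr mulr0 subr0 normr0 mulr0.
rewrite /GRing.scale /= mulr1 addr0 => hh.
have -> : f h - f 0 - m * h = - ((m - h^-1 * (f h - f 0)) * h).
  by rewrite mulrBl mulrAC mulVf// mul1r opprB.
by rewrite normrN normrM ler_wpM2r.
Qed.

(** The derivative at 0 is obtained from the real derivatives at 0 of exp, cos
    and sin, since cexp (x + i y) - 1 - (x + i y) has real part
    (exp x - 1 - x) + exp x (cos y - 1) and imaginary part
    exp x (sin y - y) + (exp x - 1) y. *)
Lemma cexp_littleo e : 0 < e ->
  exists2 r, 0 < r & forall z, normc z < r -> normc (cexp z - 1 - z) <= e * normc z.
Proof.
move=> e0; wlog e1 : e e0 / e < 1.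
  move=> H; have m0 : 0 < Num.min e (1 / 2) by rewrite lt_min e0 divr_gt0.
  have m1 : Num.min e (1 / 2) < 1.
    by rewrite gt_min; apply/orP; right; rewrite ltr_pdivrMr// mul1r ltr1n.
  have [r r0 hr] := H _ m0 m1; exists r => // z /hr; move/le_trans; apply.
  by rewrite ler_wpM2r ?normc_ge0// ge_min lexx.
have e8 : 0 < e / 8 by rewrite divr_gt0.
have /nbhs_ballP[r1 /= r10 h1] := derive_littleo (is_derive_expR 0) e8.
have /nbhs_ballP[r2 /= r20 h2] := derive_littleo (is_derive_cos 0) e8.
have /nbhs_ballP[r3 /= r30 h3] := derive_littleo (is_derive_sin 0) e8.
exists (Num.min (Num.min r1 r2) (Num.min r3 (e / 8))).
  by rewrite !lt_min r10 r20 r30.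
move=> -[x y] zr; set N := normc _ in zr *.
have xN : `|x| <= N := Re_le_normc (x +i* y).
have yN : `|y| <= N := Im_le_normc (x +i* y).
have N0 : 0 <= N := normc_ge0 _.
move: zr; rewrite !lt_min -andbA => /andP[N1 /andP[N2 /andP[N3 N4]]].
have inb (t s : R) : `|t| <= N -> N < s -> ball (0 : R) s t.
  by move=> tN Ns; rewrite -ball_normE /= sub0r normrN; exact: le_lt_trans Ns.
have := h1 x (inb _ _ xN N1); rewrite expR0 mul1r => ex.
have := h2 y (inb _ _ yN N2); rewrite cos0 sin0 oppr0 mul0r subr0 => cy.
have := h3 y (inb _ _ yN N3); rewrite sin0 cos0 subr0 mul1r => sy.
have -> : cexp (x +i* y) - 1 - (x +i* y) =
   ((expR x - 1 - x) + expR x * (cos y - 1)) +i*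
   (expR x * (sin y - y) + (expR x - 1) * y).
  by rewrite /cexp /=; simpc; congr (_ +i* _); ring.
have b1 : `|expR x - 1 - x| <= e / 8 * N.
  by apply: le_trans ex _; rewrite ler_wpM2l// ltW.
have b2 : `|cos y - 1| <= e / 8 * N.
  by apply: le_trans cy _; rewrite ler_wpM2l// ltW.
have b3 : `|sin y - y| <= e / 8 * N.
  by apply: le_trans sy _; rewrite ler_wpM2l// ltW.
have b4 : `|expR x - 1| <= e / 4.
  have -> : expR x - 1 = (expR x - 1 - x) + x by rewrite subrK.
  apply: le_trans (ler_normD _ _) _.
  have : e / 8 * N <= 1 * N by rewrite ler_wpM2r//; lra.
  by move: b1 xN N4; lra.
have b5 : expR x <= 2 by move: b4; rewrite ler_norml => /andP[_]; lra.
apply: le_trans (normc_le_ReIm _ _) _.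
have c1 : `|expR x * (cos y - 1)| <= 2 * (e / 8 * N).
  by rewrite normrM (ger0_norm (expR_ge0 _)) ler_pM// expR_ge0.
have c2 : `|expR x * (sin y - y)| <= 2 * (e / 8 * N).
  by rewrite normrM (ger0_norm (expR_ge0 _)) ler_pM// expR_ge0.
have c3 : `|(expR x - 1) * y| <= e / 4 * N by rewrite normrM ler_pM.
have := lerD (le_trans (ler_normD _ _) (lerD b1 c1)) (le_trans (ler_normD _ _) (lerD c2 c3)).
have eN : 0 <= e * N := mulr_ge0 (ltW e0) N0.
by move=> /le_trans; apply; lra.
Qed.

Lemma differentiable_cexp (z : Co) : differentiable (@cexp R : Co -> Co) z.
Proof.
apply/derivable1_diffP/cvg_ex; exists (cexp z : Co) => /=.
apply/cvg_normcP => e e0.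
have e1 : 0 < e / (2 * normc (cexp z)).
  by rewrite divr_gt0// mulr_gt0// normc_gt0// cexp_neq0.
have [r r0 hr] := cexp_littleo e1.
rewrite near_withinE; apply/nbhs_normcP; exists r => // h; rewrite subr0 => hr0 h0.
rewrite /GRing.scale /= mulr1 cexpD.
have -> : h^-1 * (cexp h * cexp z - cexp z) - cexp z = cexp z * (cexp h - 1 - h) / h.
  by field.
rewrite -mulrA normcM [normc (_ / h)]normcM normcV mulrA ltr_pdivrMr ?normc_gt0//.
have zn : 0 < normc (cexp z) by rewrite normc_gt0 ?cexp_neq0.
apply: le_lt_trans (_ : _ <= normc (cexp z) * (e / (2 * normc (cexp z)) * normc h)) _.
  by rewrite ler_pM2l// hr.
rewrite mulrA ltr_pM2r ?normc_gt0//.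
have -> : normc (cexp z) * (e / (2 * normc (cexp z))) = e / 2 by field; rewrite gt_eqF.
lra.
Qed.

End ComplexExponential.

(** * Roots of unity *)

Section UnitCircle.
Variable R : realType.
Local Notation C := R[i].
Local Notation Co := (R[i])^o.
Implicit Types (z w : C) (x y : R).

Definition e2pi z : C := cexp (2 * pi%:C * 'i%C * z).

Lemma e2piD z w : e2pi (z + w) = e2pi z * e2pi w.
Proof. by rewrite /e2pi mulrDr cexpD. Qed.

Lemma e2pi_neq0 z : e2pi z != 0.
Proof. exact: cexp_neq0. Qed.

Lemma e2pi0 : e2pi 0 = 1.
Proof. by rewrite /e2pi mulr0 cexp0. Qed.

Lemma e2piN z : e2pi (- z) = (e2pi z)^-1.
Proof. by rewrite /e2pi mulrN cexpN. Qed.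

Lemma e2pi_intmul z (n : int) : e2pi (z *~ n) = e2pi z ^ n.
Proof. by rewrite /e2pi mulrzAr cexp_intmul. Qed.

Lemma e2pi_natmul z n : e2pi (z *+ n) = e2pi z ^+ n.
Proof. by rewrite /e2pi mulrnAr cexp_natmul. Qed.

Lemma e2pi_real x : e2pi x%:C = cos (2 * pi * x) +i* sin (2 * pi * x).
Proof.
rewrite /e2pi /cexp.
have -> : 2 * pi%:C * 'i%C * x%:C = 0 +i* (2 * pi * x) :> C.
  by rewrite -(rmorph_nat (real_complex R)) -!rmorphM; simpc.
by rewrite /= expR0 mul1r.
Qed.

Lemma e2pi1 : e2pi 1 = 1.
Proof.
by rewrite -[1]/(1%:C) e2pi_real mulr1 mulr_natl cos2pi sin2pi.
Qed.

Lemma e2pi_int (n : int) : e2pi n%:~R = 1.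
Proof. by rewrite e2pi_intmul e2pi1 exp1rz. Qed.

Lemma normc_e2pi z : normc (e2pi z) = expR (- (2 * pi * complex.Im z)).
Proof.
rewrite /e2pi normc_cexp; congr expR; case: z => a b.
by rewrite -(rmorph_nat (real_complex R)) -rmorphM; simpc.
Qed.

Lemma e2pi_eq1 x : 0 < x < 1 -> e2pi x%:C != 1.
Proof.
move=> /andP[x0 x1]; rewrite e2pi_real; apply/eqP => -[+ _].
have p0 := pi_gt0 R.
have : 0 < sin (pi * x) by rewrite sin_gt0_pi// mulr_gt0//= -[ltRHS]mulr1 ltr_pM2l.
have -> : 2 * pi * x = pi * x + pi * x by ring.
rewrite cosD; have := cos2Dsin2 (pi * x).
by move: (sin _) (cos _) => s c h1 h2 h3; nra.
Qed.

End UnitCircle.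

Section RootsOfUnity.
Variables (R : realType) (q : nat).
Hypothesis q_gt0 : (0 < q)%N.
Local Notation C := R[i].
Let rho : C := e2pi (q%:R)^-1.

Lemma root_unity_int (n : int) : e2pi (n%:~R / q%:R) = rho ^ n :> C.
Proof. by rewrite mulrzl e2pi_intmul. Qed.

Lemma root_unity_order : rho ^+ q = 1.
Proof.
rewrite -e2pi_natmul; have -> : q%:R^-1 *+ q = 1 :> C; last exact: e2pi1.
by rewrite -[LHS]mulr_natl divff// pnatr_eq0 -lt0n.
Qed.

Lemma root_unity_eq1 (n : nat) : (0 < n < q)%N -> rho ^+ n != 1.
Proof.
move=> /andP[n0 nq]; rewrite -e2pi_natmul.
have -> : q%:R^-1 *+ n = (n%:R / q%:R : R)%:C :> C.
  by rewrite -[LHS]mulr_natl rmorphM fmorphV !rmorph_nat.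
by apply: e2pi_eq1; rewrite divr_gt0 ?ltr0n// ltr_pdivrMr ?ltr0n// mul1r ltr_nat.
Qed.

Lemma root_unity_prim : q.-primitive_root rho.
Proof.
rewrite /primitive_root_of_unity q_gt0; apply/forallP => i; rewrite unity_rootE.
have [->|iq] := eqVneq i.+1 q; first by rewrite root_unity_order !eqxx.
by rewrite eqbF_neg root_unity_eq1//= ltn_neqAle iq ltn_ord.
Qed.

Lemma root_unityP (t : C) : t ^+ q = 1 -> exists n : nat, t = e2pi (n%:~R / q%:R).
Proof.
move=> tq; have [n ->] := prim_rootP root_unity_prim tq.
by exists n; rewrite root_unity_int.
Qed.

Lemma normc_root_unity (t : C) : t ^+ q = 1 -> normc t = 1.
Proof.
move=> /root_unityP[n ->].
have -> : n%:~R / q%:R = (n%:R / q%:R : R)%:C :> C by rewrite rmorphM fmorphV !rmorph_nat.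
by rewrite normc_e2pi /= mulr0 oppr0 expR0.
Qed.

(** If the quotient z = s / t is not 1, its powers z^0, ..., z^(q-1) add up to 0;
    but they are all close to 1 when z is. *)
Lemma root_unity_separated (s t : C) :
  s ^+ q = 1 -> t ^+ q = 1 -> normc (s - t) < q%:R^-1 -> s = t.
Proof.
move=> sq tq st; have t0 : t != 0.
  by apply: contra_eq_neq tq => ->; rewrite expr0n gtn_eqF// eq_sym oner_eq0.
have qR : 0 < q%:R :> R by rewrite ltr0n.
pose z := s / t; have zq : z ^+ q = 1 by rewrite expr_div_n sq tq divr1.
have z1 : normc (z - 1) < q%:R^-1.
  have -> : z - 1 = (s - t) / t by rewrite mulrBl divff.
  by rewrite normcM normcV (normc_root_unity tq) invr1 mulr1.
suff : z - 1 = 0 by move/eqP; rewrite subr_eq0 => /eqP z1'; rewrite -[s](divfK t0) -/z z1' mul1r.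
apply: contraTeq z1 => z10; rewrite -leNgt.
have S0 : \sum_(i < q) z ^+ i = 0.
  by apply: (mulfI z10); rewrite -subrX1 zq subrr mulr0.
have nz : normc z = 1 by rewrite normcM normcV !normc_root_unity// invr1 mulr1.
have pw i : normc (z ^+ i - 1) <= i%:R * normc (z - 1).
  elim: i => [|i IH]; first by rewrite expr0 subrr normc0 mul0r.
  have -> : z ^+ i.+1 - 1 = z * (z ^+ i - 1) + (z - 1) by rewrite exprS; ring.
  apply: le_trans (ler_normcD _ _) _; rewrite normcM nz mul1r.
  by rewrite -natr1 mulrDl mul1r lerD2r.
have : normc (\sum_(i < q) (1 - z ^+ i)) = q%:R.
  by rewrite sumrB S0 subr0 sumr_const card_ord -(rmorph_nat (real_complex R)) normc_real ger0_norm.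
move=> qE; have : q%:R <= q%:R * (q%:R * normc (z - 1)).
  rewrite -{1}qE; apply: le_trans (ler_normc_sum _ _ _) _.
  apply: (@le_trans _ _ (\sum_(i < q) q%:R * normc (z - 1))).
    apply: ler_sum => i _; rewrite normcC; apply: le_trans (pw i) _.
    by rewrite ler_wpM2r ?normc_ge0// ler_nat ltnW.
  by rewrite sumr_const card_ord -[leLHS]mulr_natl.
by rewrite ler_pMr// => h; rewrite -[q%:R^-1]mul1r ler_pdivrMr// mulrC.
Qed.

End RootsOfUnity.

(** * Plane waves *)

Section PlaneWaves.
Variables (R : realType) (d : nat) (q : 'I_d -> nat).
Hypothesis q_gt0 : forall j, (0 < q j)%N.
Local Notation C := R[i].
Implicit Types (k : 'rV[C]_d) (u v : zvec d -> C) (V : zvec d -> R) (n m : zvec d).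
Local Notation pt := (@cell d q).
Local Notation Q := #|{: cell_index q}|.

Lemma q_neq0 j : (q j)%:R != 0 :> C.
Proof. by rewrite pnatr_eq0 -lt0n. Qed.

(** These are the numbers w_j, with w_j ^ q_j the Floquet factor. *)
Definition axis_wave k j : C := e2pi (k 0 j / (q j)%:R).

Definition plane_wave k n : C := \prod_j axis_wave k j ^ (n 0 j).

Definition free_eigenvalue k : C := \sum_j (axis_wave k j + (axis_wave k j)^-1).

(** A quasimomentum and its integer translates have the same Floquet-Bloch
    functions; the translates are used to index the plane waves among them. *)
Definition int_shift n : 'rV[C]_d := map_mx intr n.

Lemma wave_neq0 k j : axis_wave k j != 0.
Proof. exact: e2pi_neq0. Qed.

Lemma floquet_factorE k j : floquet_factor k j = e2pi (k 0 j).
Proof. by []. Qed.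

Lemma wave_exp k j : axis_wave k j ^+ q j = floquet_factor k j.
Proof.
rewrite floquet_factorE -e2pi_natmul; congr e2pi.
by rewrite -[LHS]mulr_natr divfK// q_neq0.
Qed.

Lemma waveD k k' j : axis_wave (k + k') j = axis_wave k j * axis_wave k' j.
Proof. by rewrite /axis_wave mxE mulrDl e2piD. Qed.

Lemma wave_int_shift n j : axis_wave (int_shift n) j = e2pi (q j)%:R^-1 ^ (n 0 j).
Proof. by rewrite /axis_wave mxE root_unity_int. Qed.

Lemma floquet_factor_int_shift k n j :
  floquet_factor (k + int_shift n) j = floquet_factor k j.
Proof. by rewrite !floquet_factorE !mxE e2piD e2pi_int mulr1. Qed.

Lemma plane_wave_neq0 k n : plane_wave k n != 0.
Proof. by apply/prodf_neq0 => j _; apply: expfz_neq0; exact: wave_neq0. Qed.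

Lemma plane_waveD k n m : plane_wave k (n + m) = plane_wave k n * plane_wave k m.
Proof.
rewrite /plane_wave -big_split; apply: eq_bigr => j _ /=.
by rewrite mxE expfzDr// wave_neq0.
Qed.

Lemma plane_wave0 k : plane_wave k 0 = 1.
Proof. by rewrite /plane_wave big1// => j _; rewrite mxE expr0z. Qed.

Lemma plane_waveN k n : plane_wave k (- n) = (plane_wave k n)^-1.
Proof.
apply: (mulIf (plane_wave_neq0 k n)); rewrite mulVf ?plane_wave_neq0//.
by rewrite -plane_waveD addNr plane_wave0.
Qed.

Lemma plane_waveB k n m : plane_wave k (n - m) = plane_wave k n / plane_wave k m.
Proof. by rewrite plane_waveD plane_waveN. Qed.

Lemma plane_waveDl k k' n :
  plane_wave (k + k') n = plane_wave k n * plane_wave k' n.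
Proof.
rewrite /plane_wave -big_split; apply: eq_bigr => j _ /=.
by rewrite waveD exprzMl// unitfE wave_neq0.
Qed.

Lemma plane_wave_delta k (s : int) j :
  plane_wave k (s *: delta_mx 0 j) = axis_wave k j ^ s.
Proof.
rewrite /plane_wave (bigD1 j)//= big1 ?mulr1 => [|i ij].
  by rewrite !mxE !eqxx mulr1.
by rewrite !mxE (negbTE ij) andbF mulr0 expr0z.
Qed.

Lemma normc_expz1 (z : C) (s : int) : normc z = 1 -> normc (z ^ s) = 1.
Proof.
move=> z1; have zn p : normc (z ^+ p) = 1.
  by elim: p => [|p IH]; rewrite ?expr0 ?normc1// exprS normcM z1 IH mulr1.
by case: s => p; [exact: zn|rewrite NegzE -exprnN normcV zn invr1].
Qed.

Lemma normc_int_wave n m : normc (plane_wave (int_shift n) m) = 1.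
Proof.
rewrite /plane_wave; elim/big_rec: _ => [|j z _ z1]; first exact: normc1.
rewrite normcM z1 mulr1 wave_int_shift.
by do 2!apply: normc_expz1; apply: (normc_root_unity (q_gt0 j)); exact: root_unity_order.
Qed.

Lemma plane_wave_deltaE k j : plane_wave k (delta_mx 0 j) = axis_wave k j.
Proof. by rewrite -[delta_mx 0 j]scale1r plane_wave_delta expr1z. Qed.

Lemma plane_wave_floquet k : floquet q k (plane_wave k).
Proof.
move=> n j; rewrite plane_waveD plane_wave_delta mulrC -wave_exp; congr (_ * _).
Qed.

Lemma laplacian_plane_wave k n :
  laplacian (plane_wave k) n = free_eigenvalue k * plane_wave k n.
Proof.
rewrite laplacianE mulr_suml; apply: eq_bigr => j _.
by rewrite !plane_waveD plane_waveN plane_wave_deltaE -mulrDr mulrC.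
Qed.

Lemma floquetM k k' u v :
  floquet q k u -> floquet q k' v -> floquet q (k + k') (fun n => u n * v n).
Proof.
move=> hu hv n j; rewrite hu hv !floquet_factorE mxE e2piD; ring.
Qed.

Lemma plane_waveV_floquet k : floquet q (- k) (fun n => (plane_wave k n)^-1).
Proof.
move=> n j; rewrite plane_wave_floquet invfM !floquet_factorE mxE e2piN //.
Qed.

(** Translation permutes the points of the cell modulo the period lattice. *)
Lemma sum_cell_shift u m : floquet q 0 u ->
  \sum_a u (pt a + m) = \sum_a u (pt a).
Proof.
move=> pu; pose red n : zvec d := \row_j (n 0%R j %% (q j)%:Z)%Z.
have uE n : u n = u (red n).
  rewrite -{1}(floquet_extE pu) /floquet_ext big1 ?mul1r// => j _.
  by rewrite floquet_factorE mxE e2pi0 exp1rz.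
have /choice[s sE] a : exists b, pt b = red (pt a + m).
  exact: cell_surj.
have s_inj : injective s.
  move=> a b sab; apply: (@cell_inj d q); apply/rowP => j.
  have /rowP/(_ j) : red (pt a + m) = red (pt b + m) by rewrite -!sE sab.
  rewrite !mxE => /eqP; rewrite eqz_modDr => /eqP.
  by rewrite !modz_small ?ltz_nat ?ltn_ord.
rewrite [RHS](reindex_inj s_inj) /=; apply: eq_bigr => a _.
by rewrite uE sE.
Qed.

Lemma cell_mod (a : 'I_Q) : (\row_j (pt a 0%R j %% (q j)%:Z)%Z) = pt a.
Proof. by apply/rowP => j; rewrite !mxE modz_small// ltz_nat ltn_ord. Qed.

Lemma floquet_ext_cell k u (a : 'I_Q) : floquet_ext q k u (pt a) = u (pt a).
Proof.
rewrite /floquet_ext cell_mod big1 ?mul1r// => j _.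
by rewrite !mxE divz_small// ltz_nat ltn_ord.
Qed.

(** Orthogonality of the characters of the finite group Z^d / Gamma. When the
    summation index is translated by a unit vector, the sum is multiplied by a
    root of unity, which for a suitable direction is not 1. *)
Lemma sum_int_waves (a b : 'I_Q) :
  \sum_(m < Q) plane_wave (int_shift (pt m)) (pt b - pt a) =
  (if a == b then Q%:R else 0).
Proof.
set S := \sum_m _; have [ab|nab] := eqVneq a b.
  rewrite /S ab subrr; under eq_bigr do rewrite plane_wave0.
  by rewrite sumr_const card_ord.
pose n := pt b - pt a.
have [j jab] : exists j, pt a 0 j != pt b 0 j.
  apply: contrapT => /forallNP h; move/eqP: nab; apply; apply: (@cell_inj d q).
  by apply/rowP => j; apply/eqP; apply: contrapT => /negP/h.
pose v (m : zvec d) := plane_wave (int_shift m) n.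
have vper : floquet q 0 v.
  move=> m i; rewrite floquet_factorE mxE e2pi0 mul1r /v.
  have -> : int_shift (m + (q i)%:Z *: delta_mx 0 i) =
     int_shift m + int_shift ((q i)%:Z *: delta_mx 0 i) by rewrite /int_shift raddfD.
  rewrite plane_waveDl -[RHS]mulr1; congr (_ * _).
  rewrite /plane_wave big1// => l _; rewrite wave_int_shift !mxE eqxx /=.
  have [->|_] := eqVneq l i; last by rewrite mulr0 expr0z exp1rz.
  by rewrite mulr1 -exprnP root_unity_order ?exp1rz.
have vshift m : v (m + delta_mx 0 j) = e2pi (q j)%:R^-1 ^ (n 0 j) * v m.
  rewrite /v.
  have -> : int_shift (m + delta_mx 0 j) = int_shift m + int_shift (delta_mx 0 j).
    by rewrite /int_shift raddfD.
  rewrite plane_waveDl mulrC; congr (_ * _).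
  rewrite /plane_wave (bigD1 j)//= big1 ?mulr1 => [|i ij].
    by rewrite wave_int_shift mxE !eqxx expr1z.
  by rewrite wave_int_shift mxE (negbTE ij) andbF expr0z exp1rz.
have SE : S = e2pi (q j)%:R^-1 ^ (n 0 j) * S.
  rewrite -[LHS]/(\sum_m v (pt m)) -[LHS](sum_cell_shift (delta_mx 0 j) vper) mulr_sumr.
  by apply: eq_bigr => m _; rewrite vshift.
apply/eqP; apply: contraTT isT => S0.
have : e2pi (q j)%:R^-1 ^ (n 0 j) = 1 :> C.
  by apply: (mulIf S0); rewrite mul1r -SE.
rewrite /n !mxE => e1.
have : (e2pi (q j)%:R^-1 : C) ^+ (enum_val b j) = e2pi (q j)%:R^-1 ^+ (enum_val a j).
  rewrite !exprnP -[(enum_val b j : nat)%:Z](subrK (enum_val a j : nat)%:Z).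
  by rewrite expfzDr ?e2pi_neq0// e1 mul1r.
move/eqP; rewrite (eq_prim_root_expr (root_unity_prim R (q_gt0 j))) !modn_small ?ltn_ord//.
by move/eqP => vab; move: jab; rewrite !mxE vab eqxx.
Qed.

End PlaneWaves.

(** * Floquet-Bloch eigenvalues *)

Lemma exists_maximizer (R : realDomainType) n (i0 : 'I_n) (F : 'I_n -> R) :
  exists i, forall j, F j <= F i.
Proof.
exists [arg max_(i > i0) F i]%O.
by case: arg_maxP => // i _ h j; exact: h.
Qed.

Section BlochSpectrum.
Variables (R : realType) (d : nat) (q : 'I_d -> nat).
Hypothesis q_gt0 : forall j, (0 < q j)%N.
Local Notation C := R[i].
Implicit Types (k : 'rV[C]_d) (u v : zvec d -> C) (V : zvec d -> R) (n : zvec d).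
Local Notation Q := #|{: cell_index q}|.
Local Notation pt := (@cell d q).
Local Notation plane_wave := (plane_wave q).
Local Notation free_eigenvalue := (free_eigenvalue q).

Lemma bloch_varietyP V k (l : C) : bloch_variety q V (k, l) <->
  exists u, [/\ floquet q k u, (exists a, u (pt a) != 0) &
    forall a, schrodinger V u (pt a) = l * u (pt a)].
Proof.
rewrite /bloch_variety /=; set M := floquet_mx q V k.
have act u : floquet q k u -> forall a,
    ((M - l%:M) *m \col_b u (pt b)) a 0 = schrodinger V u (pt a) - l * u (pt a).
  move=> fu a; rewrite (floquet_mxP q_gt0 V a fu) -/M.
  rewrite mulmxBl mul_scalar_mx; move: M => M; rewrite !mxE; congr (_ - _).
  by apply: eq_bigr => b _; rewrite mxE.
have detP : \det (M - l%:M) = 0 <-> exists2 w : 'cV_Q, w != 0 & (M - l%:M) *m w = 0.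
  rewrite -det_tr; split=> [/eqP/det0P[w w0 wM]|[w w0 wM]].
    exists w^T; first by rewrite trmx_eq0.
    by rewrite -(trmxK (M - _)) -trmx_mul wM trmx0.
  apply/eqP/det0P; exists w^T; first by rewrite trmx_eq0.
  by rewrite -trmx_mul wM trmx0.
rewrite detP; split=> [[w w0 wM]|[u [fu [a ua] hu]]].
  pose u0 n : C := \sum_b w b 0 * (n == pt b)%:R.
  have u0E a : u0 (pt a) = w a 0.
    rewrite /u0 (bigD1 a)//= eqxx mulr1 big1 ?addr0// => b ba.
    by rewrite (inj_eq (@cell_inj d q)) eq_sym (negbTE ba) mulr0.
  have fu := floquet_ext_floquet q_gt0 k u0.
  exists (floquet_ext q k u0); split=> //.
    have /cV0Pn[b wb] := w0; exists b.
    by rewrite floquet_ext_cell u0E.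
  move=> a; apply/eqP; rewrite -subr_eq0 -(act _ fu).
  have -> : \col_b floquet_ext q k u0 (pt b) = w.
    by apply/colP => b; rewrite !mxE floquet_ext_cell u0E.
  by rewrite wM mxE.
exists (\col_b u (pt b)); first by apply/cV0Pn; exists a; rewrite mxE.
by apply/colP => b; rewrite act// hu subrr mxE.
Qed.

(** The plane wave with quasimomentum [k] is an eigenfunction. *)
Lemma free_bloch k (c : R) : bloch_variety q (cst c) (k, c%:C + free_eigenvalue k).
Proof.
apply/bloch_varietyP; exists (plane_wave k); split.
- exact: plane_wave_floquet.
- have a : 'I_Q by apply: (Ordinal (n := Q) (m := 0)); apply/card_gt0P;
    exists [ffun j => Ordinal (q_gt0 j)].
  by exists a; exact: plane_wave_neq0.
- move=> a; by rewrite /schrodinger laplacian_plane_wave// mulrDl addrC.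
Qed.

Lemma bloch_int_shift V k n (l : C) :
  bloch_variety q V (k + int_shift R n, l) -> bloch_variety q V (k, l).
Proof.
move/bloch_varietyP => [u [fu u0 hu]]; apply/bloch_varietyP; exists u; split=> //.
by move=> m j; rewrite fu floquet_factor_int_shift.
Qed.

(** In the Fourier coefficients F u m of an eigenfunction u, the equation reads
    (l - A_m) F u m = F (V u) m, where A_m is the free eigenvalue. Take m with
    |F u m| maximal: by Fourier inversion this maximum bounds |u| on the cell, up
    to the modulus of the plane wave, hence it bounds F (V u) m up to the sum of
    |V|. Dividing out the plane wave makes the bound independent of k. *)
Lemma bloch_near_free V k (l : C) : bloch_variety q V (k, l) -> exists m : 'I_Q,
  normc (l - free_eigenvalue (k + int_shift R (pt m))) <= \sum_a `|V (pt a)|.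
Proof.
move/bloch_varietyP => [u [fu [a0 ua0] hu]].
pose chi m := plane_wave (k + int_shift R (pt m)).
pose F u (m : 'I_Q) : C := \sum_a u (pt a) / chi m (pt a).
have [p pdef] : exists p : 'I_Q -> C, forall a, p a = u (pt a) / plane_wave k (pt a).
  by eexists.
have chi_neq0 m n : chi m n != 0 by exact: plane_wave_neq0.
have fchi m : floquet q 0 (fun n => u n / chi m n).
  have := floquetM fu (@plane_waveV_floquet _ _ _ q_gt0 (k + int_shift R (pt m))).
  move=> h n j; rewrite h !floquet_factorE !mxE opprD addrA subrr add0r.
  by rewrite e2piN e2pi_int invr1 e2pi0.
have Flap m : F (laplacian u) m = free_eigenvalue (k + int_shift R (pt m)) * F u m.
  rewrite /F; under eq_bigr do rewrite laplacianE mulr_suml.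
  rewrite exchange_big mulr_suml /=; apply: eq_bigr => j _.
  under eq_bigr do rewrite mulrDl; rewrite big_split mulrDl /=; congr (_ + _).
    rewrite -[in RHS](sum_cell_shift q_gt0 (delta_mx 0 j) (fchi m)) mulr_sumr.
    apply: eq_bigr => a _; rewrite /chi plane_waveD// plane_wave_deltaE.
    have := chi_neq0 m (pt a); rewrite /chi => c0.
    by field; rewrite c0 wave_neq0.
  rewrite -[in RHS](sum_cell_shift q_gt0 (- delta_mx 0 j) (fchi m)) mulr_sumr.
  apply: eq_bigr => a _; rewrite /chi plane_waveD// plane_waveN// plane_wave_deltaE.
  have := chi_neq0 m (pt a); rewrite /chi => c0.
  by field; rewrite c0 wave_neq0.
have pE a b m : u (pt a) / chi m (pt a) * plane_wave (int_shift R (pt m)) (pt b) =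
    p a * plane_wave (int_shift R (pt m)) (pt b - pt a).
  have alg (x y z w : C) : x / (y * z) * w = x / y * (w / z).
    by rewrite invfM -!mulrA (mulrC z^-1).
  by rewrite plane_waveD// plane_waveN// /chi plane_waveDl// pdef alg.
have inv b : Q%:R * p b = \sum_m F u m * plane_wave (int_shift R (pt m)) (pt b).
  rewrite /F; under [RHS]eq_bigr do rewrite mulr_suml.
  rewrite exchange_big /=.
  under [RHS]eq_bigr do (under eq_bigr do rewrite pE; rewrite -mulr_sumr sum_int_waves//).
  rewrite (bigD1 b) //= eqxx big1 ?addr0; first exact: mulrC.
  by move=> a ab; rewrite (negbTE ab) mulr0.
have [mx mxP] : exists mx, forall m, normc (F u m) <= normc (F u mx).
  exact: (exists_maximizer a0 (fun m => normc (F u m))).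
have Q0 : 0 < Q%:R :> R by rewrite ltr0n; apply/card_gt0P; exists (enum_val a0).
have p_le b : normc (p b) <= normc (F u mx).
  rewrite -(ler_pM2l Q0) -[Q%:R in leLHS]ger0_norm ?ler0n// -normc_real rmorph_nat.
  rewrite -normcM inv; apply: le_trans (ler_normc_sum _ _ _) _.
  apply: (@le_trans _ _ (\sum_(m < Q) normc (F u mx))).
    by apply: ler_sum => m _; rewrite normcM normc_int_wave// mulr1.
  by rewrite sumr_const card_ord mulr_natl.
have Fmx : 0 < normc (F u mx).
  apply: lt_le_trans (p_le a0); rewrite normc_gt0// pdef mulf_neq0// invr_neq0//.
  exact: plane_wave_neq0.
exists mx; rewrite -(ler_pM2r Fmx) -normcM mulrBl -Flap.
have -> : l * F u mx - F (laplacian u) mx =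
    \sum_a (V (pt a))%:C * (u (pt a) / chi mx (pt a)).
  rewrite /F mulr_sumr -sumrB; apply: eq_bigr => a _.
  by rewrite mulrA -mulrBl -hu /schrodinger addrAC subrr add0r mulrA.
apply: le_trans (ler_normc_sum _ _ _) _; rewrite mulr_suml; apply: ler_sum => a _.
rewrite normcM normc_real ler_wpM2l//; apply: le_trans (p_le a).
have -> : u (pt a) / chi mx (pt a) = p a / plane_wave (int_shift R (pt mx)) (pt a).
  have alg (x y z : C) : x / (y * z) = x / y / z by rewrite invfM mulrA.
  by rewrite /chi plane_waveDl// pdef alg.
have nn (x y : C) : normc y = 1 -> normc (x / y) = normc x.
  by move=> y1; rewrite normcM normcV y1 invr1 mulr1.
by rewrite (nn (p a) _ (normc_int_wave R q_gt0 (pt mx) (pt a))).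
Qed.

End BlochSpectrum.

(** * Isospectral potentials *)

Section EigenvectorMatrix.
Variables (F : fieldType) (n : nat).
Implicit Types (M U : 'M[F]_n) (d : 'rV[F]_n).

Lemma mulmx_diagE d (x : 'cV[F]_n) i : (diag_mx d *m x) i 0 = d 0 i * x i 0.
Proof. by rewrite mul_diag_mx mxE. Qed.

(** A dependency between eigenvectors of distinct eigenvalues can be shortened
    by applying [M - d_i]. *)
Lemma eigenvector_matrix_unit M U d : M *m U = U *m diag_mx d ->
  injective (d 0) -> (forall j, col j U != 0) -> U \in unitmx.
Proof.
move=> MU dinj U0.
have ker0 p (x : 'cV_n) : (#|[pred i | (x i 0 != 0)%R]| <= p)%N -> U *m x = 0 -> x = 0.
  elim: p x => [|p IH] x.
    rewrite leqn0 => /eqP/card0_eq x0 _; apply/colP => i; have := x0 i.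
    by rewrite !inE mxE => /negbFE/eqP.
  move=> xp Ux; apply/eqP; apply: contraT => /cV0Pn[i xi].
  pose y := diag_mx d *m x - d 0 i *: x.
  have yE j : y j 0 = (d 0 j - d 0 i) * x j 0.
    by rewrite /y mxE mulmx_diagE !mxE mulrBl.
  have Uy : U *m y = 0.
    by rewrite /y mulmxBr mulmxA -MU -mulmxA -scalemxAr Ux mulmx0 scaler0 subr0.
  have y0 : y = 0.
    apply: IH Uy; rewrite -ltnS; apply: leq_trans xp; apply: proper_card.
    apply/properP; split.
      by apply/fintype.subsetP => j; rewrite !inE yE mulf_eq0 negb_or => /andP[].
    by exists i; rewrite !inE ?xi// yE subrr mul0r eqxx.
  have xE : x = x i 0 *: delta_mx i 0.
    apply/colP => j; rewrite !mxE eqxx andbT; case: eqVneq => [->|ji].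
      by rewrite mulr1.
    rewrite mulr0; have := yE j; rewrite y0 mxE => /esym/eqP.
    rewrite mulf_eq0 subr_eq0 => /orP[/eqP/dinj jE|/eqP//].
    by rewrite jE eqxx in ji.
  move: Ux; rewrite xE -scalemxAr -colE => /eqP; rewrite scaler_eq0.
  by rewrite (negbTE xi) (negbTE (U0 i)).
rewrite unitmxE unitfE -det_tr; apply/det0P => -[w w0 wU].
have /eqP := w0; apply; apply: trmx_inj; rewrite trmx0.
apply: (ker0 _ _ (leqnn _)).
by rewrite -(trmxK U) -trmx_mul wU trmx0.
Qed.

Lemma trace_conj M U D : U \in unitmx -> M *m U = U *m D -> \tr M = \tr D.
Proof.
move=> Uu MU; have -> : M = U *m D *m invmx U by rewrite -MU mulmxK.
by rewrite mxtrace_mulC mulmxA mulVmx// mul1mx.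
Qed.

Lemma trace_sqr_conj M U D : U \in unitmx -> M *m U = U *m D ->
  \tr (M *m M) = \tr (D *m D).
Proof.
by move=> Uu MU; apply: (trace_conj Uu); rewrite -mulmxA MU !mulmxA MU.
Qed.

End EigenvectorMatrix.

Section SpectrumTraces.
Variables (R : realType) (d : nat) (q : 'I_d -> nat).
Hypothesis q_gt0 : forall j, (0 < q j)%N.
Local Notation C := R[i].
Implicit Types (k : 'rV[C]_d) (u v : zvec d -> C) (V : zvec d -> R) (n : zvec d).
Local Notation Q := #|{: cell_index q}|.
Local Notation pt := (@cell d q).
Local Notation plane_wave := (plane_wave q).
Local Notation free_eigenvalue := (free_eigenvalue q).

(** For real quasimomenta the matrix is Hermitian: the two neighbours of a point
    in a given direction contribute conjugate sums, as translation by one step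
    shows. *)
Lemma bloch_real V k (l : C) : (forall j, complex.Im (k 0 j) = 0) ->
  bloch_variety q V (k, l) -> l^* = l.
Proof.
move=> kr /bloch_varietyP-/(_ q_gt0)[u [fu [a0 ua0] hu]].
have ff j : (floquet_factor k j)^* * floquet_factor k j = 1.
  rewrite mulrC -sqr_normc normcE_C floquet_factorE normc_e2pi kr mulr0 oppr0.
  by rewrite expR0 expr1n.
have per n : floquet q 0 (fun m => (u m)^* * u (m + n)).
  move=> m j; have -> : floquet_factor (0 : 'rV[C]_d) j = 1.
    by rewrite floquet_factorE mxE e2pi0.
  by rewrite addrAC !fu rmorphM mul1r mulrACA ff mul1r.
pose T (j : 'I_d) : C := \sum_a (u (pt a))^* * u (pt a + delta_mx 0 j).
have TN j : \sum_a (u (pt a))^* * u (pt a - delta_mx 0 j) = (T j)^*.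
  rewrite -(sum_cell_shift q_gt0 (delta_mx 0 j) (per (- delta_mx 0 j))) rmorph_sum.
  by apply: eq_bigr => a _; rewrite addrK rmorphM /= conjcK mulrC.
pose S : C := \sum_a (u (pt a))^* * u (pt a).
have Sr : S^* = S.
  by rewrite rmorph_sum; apply: eq_bigr => a _; rewrite rmorphM /= conjcK mulrC.
have S0 : S != 0.
  rewrite /S psumr_neq0 => [|a _]; last by rewrite mulrC mulcJ_ge0.
  apply/hasP; exists a0; rewrite ?mem_index_enum//=.
  by rewrite mulrC -sqr_normc exprn_gt0// normr_gt0.
have lS : l * S = \sum_j (T j + (T j)^*) +
    \sum_a (V (pt a))%:C * ((u (pt a))^* * u (pt a)).
  have -> : l * S = \sum_a (u (pt a))^* * schrodinger V u (pt a).
    by rewrite mulr_sumr; apply: eq_bigr => a _; rewrite hu mulrCA.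
  under eq_bigr do rewrite /schrodinger laplacianE mulrDr mulr_sumr.
  rewrite big_split exchange_big /=; congr (_ + _).
    apply: eq_bigr => j _; rewrite -[X in _ = _ + X](TN j) -big_split.
    by apply: eq_bigr => a _; rewrite mulrDr.
  by apply: eq_bigr => a _; rewrite mulrCA.
apply: (mulIf S0); rewrite -{1}Sr -rmorphM lS rmorphD !rmorph_sum; congr (_ + _).
  by apply: eq_bigr => j _; rewrite rmorphD /= conjcK addrC.
apply: eq_bigr => a _; rewrite !rmorphM /= conjcK oppr0; congr (_ * _).
by rewrite mulrC.
Qed.

Lemma floquet_mx_potential V k : floquet_mx q V k =
  floquet_mx q (cst 0) k + diag_mx (\row_a (V (pt a))%:C).
Proof.
apply/matrixP => a b; rewrite !mxE /schrodinger mul0r addr0; congr (_ + _).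
rewrite floquet_ext_cell (inj_eq (@cell_inj d q)).
by case: eqVneq => _; rewrite ?mulr1 ?mulr0.
Qed.

Section FreeMatrix.
Variable k : 'rV[C]_d.
Let M0 := floquet_mx q (cst 0) k.
Let ev (m : 'I_Q) := free_eigenvalue (k + int_shift R (pt m)).
Let D := diag_mx (\row_m ev m).
Let F := \matrix_(a < Q, m < Q) plane_wave (k + int_shift R (pt m)) (pt a).
Let G := \matrix_(m < Q, b < Q) (plane_wave (k + int_shift R (pt m)) (pt b))^-1.

Lemma plane_wave_eigen V (c : R) : (forall n, V n = c) -> forall m a,
  \sum_b floquet_mx q V k a b * plane_wave (k + int_shift R (pt m)) (pt b) =
  (c%:C + ev m) * plane_wave (k + int_shift R (pt m)) (pt a).
Proof.
move=> Vc m a; rewrite -(floquet_mxP q_gt0).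
  by rewrite /schrodinger laplacian_plane_wave// Vc mulrDl addrC.
by move=> n j; rewrite plane_wave_floquet// floquet_factor_int_shift.
Qed.

Lemma Q_neq0 : (0 < Q)%N -> Q%:R != 0 :> C.
Proof. by move=> Q0; rewrite pnatr_eq0 -lt0n. Qed.

Lemma free_mx_diag : M0 *m F = F *m D.
Proof.
apply/matrixP => a m; rewrite mul_mx_diag !mxE.
under eq_bigr do rewrite [F _ _]mxE.
by rewrite (@plane_wave_eigen _ 0)// add0r mulrC.
Qed.

Lemma wave_mx_inv : F *m G = Q%:R%:M.
Proof.
apply/matrixP => a b; rewrite mxE.
transitivity (plane_wave k (pt a - pt b) *
    \sum_(m < Q) plane_wave (int_shift R (pt m)) (pt a - pt b)).
  rewrite mulr_sumr; apply: eq_bigr => m _; rewrite [F _ _]mxE [G _ _]mxE.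
  transitivity (plane_wave (k + int_shift R (pt m)) (pt a - pt b)).
    exact/esym/plane_waveB.
  exact: plane_waveDl.
rewrite sum_int_waves// mxE eq_sym; case: eqVneq => [->|_].
  by rewrite subrr plane_wave0// mul1r.
by rewrite mulr0.
Qed.

Lemma cell_card_gt0 : (0 < Q)%N.
Proof. by apply/card_gt0P; exists [ffun j => Ordinal (q_gt0 j)]. Qed.

Lemma wave_mx_unit : F \in unitmx.
Proof.
have FG : F *m (Q%:R^-1 *: G) = 1%:M.
  by rewrite -scalemxAr wave_mx_inv scale_scalar_mx mulVf// Q_neq0// cell_card_gt0.
by have [] := mulmx1_unit FG.
Qed.

(** The plane waves diagonalise the free matrix. In a diagonal entry each of them
    meets its own inverse, so that the entry is the mean of the eigenvalues,
    whatever its position. *)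
Lemma free_mx_entry a : Q%:R * M0 a a = \sum_m ev m.
Proof.
have QM : Q%:R *: M0 = F *m D *m G.
  by rewrite -free_mx_diag -mulmxA wave_mx_inv mul_mx_scalar.
have -> : Q%:R * M0 a a = (Q%:R *: M0) a a by rewrite [RHS]mxE.
rewrite QM mxE; apply: eq_bigr => m _.
rewrite mul_mx_diag [X in X * _]mxE [F _ _]mxE [G _ _]mxE [(\row__ _) _ _]mxE.
by rewrite mulrAC mulfV ?mul1r// plane_wave_neq0.
Qed.

Lemma free_mx_trace : \tr M0 = \sum_m ev m.
Proof.
rewrite (trace_conj wave_mx_unit free_mx_diag) mxtrace_diag.
by apply: eq_bigr => m _; rewrite mxE.
Qed.

Lemma free_mx_trace2 : \tr (M0 *m M0) = \sum_m ev m ^+ 2.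
Proof.
rewrite (trace_sqr_conj wave_mx_unit free_mx_diag) mulmx_diag mxtrace_diag.
by apply: eq_bigr => m _; rewrite !mxE expr2.
Qed.

(** The numbers [c + ev m] are then the whole spectrum of [floquet_mx V k], which
    is diagonalisable. As the diagonal of the free matrix is constant, the traces
    of the matrix and of its square give the mean c and the mean square c^2 of
    the potential, so that its variance vanishes. *)
Lemma isospectral_const V (c : C) : injective ev ->
  (forall m, bloch_variety q V (k, c + ev m)) ->
  forall a, (V (pt a))%:C = c.
Proof.
move=> evinj hV.
have /choice[w wP] m : exists u, [/\ floquet q k u, (exists a, u (pt a) != 0) &
    forall a, schrodinger V u (pt a) = (c + ev m) * u (pt a)].
  exact/bloch_varietyP.
pose U := \matrix_(a < Q, m < Q) w m (pt a).
pose E := \row_(m < Q) (c + ev m).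
set M := floquet_mx q V k.
have MU : M *m U = U *m diag_mx E.
  apply/matrixP => a m; have [fu _ hu] := wP m.
  rewrite mul_mx_diag !mxE [RHS]mulrC -hu (floquet_mxP q_gt0 V a fu).
  by apply: eq_bigr => b _; rewrite [U _ _]mxE.
have Uu : U \in unitmx.
  apply: (eigenvector_matrix_unit MU) => [m1 m2|m].
    by rewrite !mxE => /addrI/evinj.
  have [_ [a ua] _] := wP m; apply/cV0Pn; exists a; rewrite !mxE; exact: ua.
pose v := \row_(a < Q) (V (pt a))%:C.
have ME : M = M0 + diag_mx v by rewrite /M floquet_mx_potential.
have Q0 := Q_neq0 cell_card_gt0.
have sumV : \sum_a v 0 a = Q%:R * c.
  have : \tr M = \tr (diag_mx E) := trace_conj Uu MU.
  rewrite ME mxtraceD free_mx_trace !mxtrace_diag.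
  under [\sum_i E 0 i]eq_bigr do rewrite mxE.
  rewrite [RHS]big_split sumr_const card_ord /= [RHS]addrC => /addrI ->.
  by rewrite mulr_natl.
have sumV2 : \sum_a v 0 a ^+ 2 = Q%:R * c ^+ 2.
  have := trace_sqr_conj Uu MU.
  rewrite ME mulmxDl !mulmxDr !mxtraceD free_mx_trace2 mulmx_diag.
  rewrite [\tr (diag_mx v *m M0)]mxtrace_mulC.
  have -> : \tr (M0 *m diag_mx v) = c * \sum_m ev m.
    rewrite mul_mx_diag /mxtrace.
    transitivity (\sum_a Q%:R^-1 * (\sum_m ev m) * v 0 a).
      apply: eq_bigr => a _; rewrite mxE; congr (_ * _).
      by rewrite -(free_mx_entry a) mulKf.
    by rewrite -mulr_sumr sumV mulrCA mulrA mulVKf// mulrC.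
  rewrite mulmx_diag !mxtrace_diag.
  have -> : \sum_i (\row_j (v 0 j * v 0 j)) 0 i = \sum_a v 0 a ^+ 2.
    by apply: eq_bigr => a _; rewrite mxE -expr2.
  have -> : \sum_i (\row_j (E 0 j * E 0 j)) 0 i =
      Q%:R * c ^+ 2 + 2 * (c * \sum_m ev m) + \sum_m ev m ^+ 2.
    under eq_bigr do rewrite !mxE -expr2 sqrrD.
    rewrite !big_split /= sumr_const card_ord -[c ^+ 2 *+ _]mulr_natl.
    by rewrite -mulr_sumr [2 * _]mulr_natl mulr2n.
  move: (\sum_m ev m ^+ 2) (\sum_m ev m) (\sum_a v 0 a ^+ 2) => s2 s1 sv.
  move: (Q%:R : C) => n h; have -> : sv = s2 + c * s1 + (c * s1 + sv) - (s2 + 2 * (c * s1)) by ring.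
  by rewrite h; ring.
pose r := (\sum_a V (pt a)) / Q%:R.
have QR : Q%:R != 0 :> R by rewrite pnatr_eq0 -lt0n cell_card_gt0.
have vE a : v 0 a = (V (pt a))%:C by rewrite mxE.
have cr : c = r%:C.
  apply: (mulfI Q0); rewrite -sumV -(rmorph_nat (real_complex R)) -rmorphM /r.
  by rewrite mulrC divfK// rmorph_sum; apply: eq_bigr => a _; exact: vE.
have sV : \sum_a V (pt a) = Q%:R * r by rewrite /r mulrC divfK.
have sV2 : \sum_a V (pt a) ^+ 2 = Q%:R * r ^+ 2.
  apply: (@complexI R); rewrite rmorphM rmorph_nat rmorphXn /= -cr -sumV2 rmorph_sum.
  by apply: eq_bigr => a _; rewrite vE rmorphXn.
have s0 : \sum_a (V (pt a) - r) ^+ 2 = 0.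
  under eq_bigr do rewrite sqrrB mulr2n.
  rewrite big_split sumrB big_split /= sV2 sumr_const card_ord -mulr_suml sV.
  by rewrite -[r ^+ 2 *+ _]mulr_natl; ring.
move=> a; rewrite cr; congr (_%:C); apply/eqP; rewrite -subr_eq0 -sqrf_eq0.
by apply/eqP; apply: (psumr_eq0P _ s0) => // b _; exact: sqr_ge0.
Qed.

End FreeMatrix.
End SpectrumTraces.

(** * Entire functions of several variables *)

Section EntireFunctions.
Variables (R : realType) (d : nat).
Local Notation C := R[i].
Local Notation Co := (R[i])^o.
Implicit Types (k : 'rV[C]_d) (f g : 'rV[C]_d -> C).

Lemma differentiable_scalel (l z : Co) : differentiable ((fun t => l * t) : Co -> Co) z.
Proof.
have idd : differentiable (id : Co -> Co) z by apply/derivable1_diffP; exact: derivable_id.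
by apply: (differentiableM _ idd); exact: differentiable_cst.
Qed.

Lemma entire_wave (q : 'I_d -> nat) j : entire (fun k => axis_wave q k j).
Proof.
move=> k; pose l : Co := 2 * pi%:C * 'i%C / (q j)%:R.
have -> : (fun k => axis_wave q k j) = @cexp R \o ((fun t => l * t) \o (fun k => k 0 j)).
  by apply/funext => k'; rewrite /= /axis_wave /e2pi /l; congr cexp; ring.
apply: (@differentiable_comp _ 'rV[Co]_d Co Co _ (@cexp R : Co -> Co)); last first.
  exact: differentiable_cexp.
apply: (@differentiable_comp _ 'rV[Co]_d Co Co); first exact: differentiable_coord.
exact: differentiable_scalel.
Qed.

Lemma entire_waveV (q : 'I_d -> nat) j : entire (fun k => (axis_wave q k j)^-1).
Proof.
move=> k; apply: (@differentiableV _ 'rV[Co]_d (fun k => axis_wave q k j)).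
  exact: entire_wave.
exact: wave_neq0.
Qed.

Lemma entireD f g : entire f -> entire g -> entire (fun k => f k + g k).
Proof. by move=> hf hg k; exact: (differentiableD (hf k) (hg k)). Qed.

Lemma entireB f g : entire f -> entire g -> entire (fun k => f k - g k).
Proof. by move=> hf hg k; exact: (differentiableB (hf k) (hg k)). Qed.

Lemma entire_cst (c : C) : entire (fun=> c : C) (d := d).
Proof. by move=> k; exact: differentiable_cst. Qed.

Lemma entireM f g : entire f -> entire g -> entire (fun k => f k * g k).
Proof. by move=> hf hg k; exact: (differentiableM (hf k) (hg k)). Qed.

Lemma entire_sum n (F : 'I_n -> 'rV[C]_d -> C) :
  (forall i, entire (F i)) -> entire (fun k => \sum_i F i k).
Proof.
move=> hF k; have := differentiable_sum (fun i => hF i k).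
by rewrite fct_sumE.
Qed.

Lemma entire_line f k v : entire f ->
  forall z : Co, differentiable ((fun t => f (k + t *: v)) : Co -> Co) z.
Proof.
move=> hf z.
have idd : differentiable (id : Co -> Co) z by apply/derivable1_diffP; exact: derivable_id.
have ld : differentiable
    ((fun t => (k : 'rV[Co]_d) + t *: (v : 'rV[Co]_d)) : Co -> 'rV[Co]_d) z.
  apply: differentiableD; first exact: differentiable_cst.
  exact: (differentiableZl _ idd).
exact: (differentiable_comp ld (hf _)).
Qed.

Lemma entire_opp f : entire f -> entire (fun k => f (- k)).
Proof.
move=> hf k; have od : differentiable ((fun k => - k) : 'rV[Co]_d -> 'rV[Co]_d)
    (k : 'rV[Co]_d).
  exact: (@differentiableN _ _ _ (id : 'rV[Co]_d -> 'rV[Co]_d)).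
exact: (differentiable_comp od (hf _)).
Qed.

Lemma entire_segment f k v : entire f -> continuous (fun t : R => f (k + t%:C *: v) : Co).
Proof.
move=> hf t; apply: (@continuous_comp R Co Co (fun t => t +i* 0) (fun t => f (k + t *: v))).
  exact: continuous_hline.
exact: (differentiable_continuous (entire_line k v hf _)).
Qed.

Lemma coordinatewise_constant (g : 'rV[C]_d -> C) :
  (forall k j t, g (k + t *: delta_mx 0 j) = g k) -> forall k, g k = g 0.
Proof.
move=> hg k; rewrite [k]row_sum_delta; elim/big_rec: _ => // j k' _ <-.
by rewrite addrC hg.
Qed.

End EntireFunctions.

(** * Entire functions close to free eigenvalues *)

Section LeadingTerm.
Variables (R : realType) (d : nat) (q : 'I_d -> nat).
Hypothesis q_gt0 : forall j, (0 < q j)%N.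
Local Notation C := R[i].
Local Notation Co := (R[i])^o.
Local Notation wave := (axis_wave q).
Implicit Types (k : 'rV[C]_d) (th : 'I_d -> C).

(** For roots of unity [th j] of order dividing [q j], this is the free eigenvalue
    at an integer translate of [k]. *)
Definition twisted_free k th : C := \sum_j (th j * wave k j + (th j * wave k j)^-1).

(** Integer translates are recorded by roots of unity because these are what the
    behaviour of [f] at infinity reveals, and because the condition is then
    visibly symmetric under the change of [k] into [- k] ([near_free_opp]). *)
Definition near_free (f : 'rV[C]_d -> C) (c : R) k th :=
  (forall j, th j ^+ q j = 1) /\ normc (f k - twisted_free k th) <= c.

Lemma normc_wave k j :
  normc (wave k j) = expR (- (2 * pi * (complex.Im (k 0 j) / (q j)%:R))).
Proof.
rewrite /wave normc_e2pi; congr expR; congr (- (_ * _)).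
have -> : (q j)%:R^-1 = ((q j)%:R^-1 : R)%:C :> C by rewrite fmorphV rmorph_nat.
by case: (k 0 j) => x y; simpc.
Qed.

Lemma normc_wave_le k j B : `|complex.Im (k 0 j)| <= B ->
  normc (wave k j) <= expR (2 * pi * B) /\ normc (wave k j)^-1 <= expR (2 * pi * B).
Proof.
move=> hB; have p0 : 0 <= 2 * pi :> R by rewrite mulr_ge0// pi_ge0.
have hq : `|complex.Im (k 0 j) / (q j)%:R| <= B.
  apply: le_trans hB; rewrite normrM normfV [`|(q j)%:R|]ger0_norm ?ler0n//.
  by rewrite ler_pdivrMr ?ltr0n// ler_peMr// ler1n.
have := hq; rewrite ler_norml => /andP[h1 h2].
rewrite normcV normc_wave -expRN opprK !ler_expR -mulrN; split; apply: ler_wpM2l => //.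
by rewrite lerNl.
Qed.

Lemma unit_mul (z w : C) : normc z = 1 -> normc (z * w) = normc w.
Proof. by move=> z1; rewrite normcM z1 mul1r. Qed.

(** Distinct roots of unity are at distance at least 4 e, where e is the tolerance
    (4 q_j)^-1. Hence the distance from phi t to the initial root is either below
    e or above 3 e, and by the intermediate value theorem it cannot pass from one
    range to the other. *)
Lemma root_continuation j (phi : R -> Co) (th : R -> C) : continuous phi ->
  (forall t, 0 <= t <= 1 -> th t ^+ q j = 1 /\
    normc (phi t - th t) < (4 * (q j)%:R)^-1) -> th 0 = th 1.
Proof.
move=> phic hth; pose e : R := (4 * (q j)%:R)^-1.
have qR : 0 < (q j)%:R :> R by rewrite ltr0n.
have e0 : 0 < e by rewrite invr_gt0 mulr_gt0.
have e4 : 4 * e = (q j)%:R^-1 by rewrite /e; field; rewrite gt_eqF.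
pose g t := normc (phi t - th 0).
have gc : continuous g.
  move=> t; apply/(@cvgrPdist_lt _ _ _ _ (nbhs_filter t)) => r r0.
  have /(cvg_normcP (nbhs_filter t))/(_ r r0) := phic t.
  apply: filterS => s; apply: le_lt_trans; rewrite distrC ler_norml.
  have -> : phi s - phi t = (phi s - th 0) - (phi t - th 0) by ring.
  rewrite -/(g s) -/(g t); apply/andP; split.
    rewrite lerNl opprB normcC; apply: le_trans (ler_subnormc _ _).
    by rewrite normcNE.
  by apply: le_trans (ler_subnormc _ _); rewrite normcNE.
have g0 : g 0 < e by rewrite /g; have [] := hth 0; rewrite ?lexx ?ler01.
apply: contrapT => nth.
have gap t : 0 <= t <= 1 -> th t <> th 0 -> 3 * e < g t.
  move=> t01 tne; have [tq te] := hth t t01.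
  have [q0 _] := hth 0 (introT andP (conj (lexx _) ler01)).
  have far : 4 * e <= normc (th t - th 0).
    rewrite leNgt e4; apply/negP => /(root_unity_separated (q_gt0 j) tq q0)/tne.
    by [].
  have : normc (th t - th 0) <= normc (phi t - th t) + g t.
    have -> : th t - th 0 = - (phi t - th t) + (phi t - th 0) by ring.
    by apply: le_trans (ler_normcD _ _) _; rewrite normcNE.
  by move: te far; rewrite -/e; lra.
have g1 : 3 * e < g 1 by apply: gap; rewrite ?ler01 ?lexx// => /esym.
have [t] : exists2 t, t \in `[0, 1] & g t = 2 * e.
  apply: IVT; first exact: ler01.
    by apply: continuous_subspaceT.
  rewrite ge_min le_max; apply/andP; split; apply/orP; [left|right]; lra.
rewrite in_itv /= => t01 gt.
have [tE|tne] := eqVneq (th t) (th 0).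
  by have [_] := hth t t01; rewrite tE -/e -/(g t) gt; lra.
by have := gap t t01 (elimN eqP tne); rewrite gt; lra.
Qed.

Variables (f : 'rV[C]_d -> C) (c : R).
Hypothesis fe : entire f.
Hypothesis fnear : forall k, exists th, near_free f c k th.

(** Where the imaginary part of [k_j] is very negative and the others are bounded
    by [B], the quotient of [f] by the wave is close to [th j]. This region is
    convex, so that [root_continuation] applies; the regions for different [B]
    share points of the [j]-th imaginary axis, so that the root is the same for
    all of them. *)
Lemma leading_root j : exists a : C, forall B : R, 0 <= B -> exists Y : R, forall k th,
  (forall i, i != j -> `|complex.Im (k 0 i)| <= B) -> complex.Im (k 0 j) <= - Y ->
  near_free f c k th -> th j = a.
Proof.
pose e : R := (4 * (q j)%:R)^-1.
have qR : 0 < (q j)%:R :> R by rewrite ltr0n.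
have e0 : 0 < e by rewrite invr_gt0 mulr_gt0.
have c0 : 0 <= c by have [th [_]] := fnear 0; apply: le_trans; exact: normc_ge0.
have p0 : 0 < pi :> R := pi_gt0 R.
pose reg (B Y : R) k := (forall i, i != j -> `|complex.Im (k 0 i)| <= B) /\
  complex.Im (k 0 j) <= - Y.
have close (B : R) : 0 <= B -> exists2 Y, 0 <= Y & forall k th, reg B Y k ->
    near_free f c k th -> normc (f k / wave k j - th j) < e.
  move=> B0; pose E := expR (2 * pi * B).
  pose K := c + d%:R * (2 * E) + 1.
  have E0 : 0 < E by exact: expR_gt0.
  have K0 : 0 < K by rewrite ltr_wpDl// addr_ge0// mulr_ge0// mulr_ge0// ltW.
  (* With this Y, the inequality 1 + x <= expR x makes the wave exceed K / e. *)
  pose Y := (q j)%:R * (K / e) / (2 * pi).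
  have Y0 : 0 <= Y.
    by apply/ltW/divr_gt0; apply: mulr_gt0 => //; exact: divr_gt0.
  exists Y => // k th [kB kY] [thq hth].
  have w0 := wave_neq0 q k j.
  have wbig : K / e < normc (wave k j).
    rewrite normc_wave; apply: lt_le_trans (expR_ge1Dx _).
    apply: (@le_lt_trans _ _ (- (2 * pi * (complex.Im (k 0 j) / (q j)%:R)))); last first.
      by rewrite ltrDr.
    rewrite -mulrN -mulNr mulrA ler_pdivlMr// mulrC.
    have <- : 2 * pi * Y = (q j)%:R * (K / e).
      by rewrite /Y mulrC divfK// gt_eqF// mulr_gt0.
    by rewrite ler_pM2l ?mulr_gt0// lerNr.
  have w1 : 1 <= normc (wave k j).
    rewrite normc_wave -[leLHS]expR0 ler_expR oppr_ge0 mulr_ge0_le0//.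
      by rewrite ltW// mulr_gt0.
    by rewrite pmulr_lle0 ?invr_gt0//; apply: le_trans kY _; rewrite oppr_le0.
  have nth i : normc (th i) = 1 by exact: (normc_root_unity (q_gt0 i) (thq i)).
  have nthV i : normc (th i)^-1 = 1 by rewrite normcV nth invr1.
  pose rest := \sum_(i | i != j) (th i * wave k i + (th i * wave k i)^-1).
  have restE : normc rest <= d%:R * (2 * E).
    apply: le_trans (ler_normc_sum _ _ _) _.
    apply: (@le_trans _ _ (\sum_(i < d | i != j) 2 * E)).
      apply: ler_sum => i ij; have [h1 h2] := normc_wave_le (kB i ij).
      apply: le_trans (ler_normcD _ _) _; rewrite invfM.
      rewrite (unit_mul _ (nth i)) (unit_mul _ (nthV i)).
      by rewrite mulr_natl mulr2n lerD.
    rewrite sumr_const -[leLHS]mulr_natl; apply: ler_wpM2r.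
      by rewrite mulr_ge0// ltW.
    by rewrite ler_nat -[leqRHS]card_ord max_card.
  have -> : f k / wave k j - th j =
      ((f k - twisted_free k th) + rest + (th j * wave k j)^-1) / wave k j.
    have -> : twisted_free k th = th j * wave k j + (th j * wave k j)^-1 + rest.
      by rewrite /twisted_free (bigD1 j).
    have t0 : th j != 0.
      by have := oner_neq0 R; rewrite -(nth j); apply: contra_neq => ->; exact: normc0.
    by field; rewrite w0 t0.
  rewrite normcM normcV ltr_pdivrMr ?normc_gt0//.
  apply: (@le_lt_trans _ _ K); last by rewrite mulrC -ltr_pdivrMr.
  rewrite /K; apply: le_trans (ler_normcD _ _) _; apply: lerD.
    by apply: le_trans (ler_normcD _ _) _; apply: lerD.
  rewrite normcV normcM nth mul1r invf_le1//; exact: lt_le_trans ltr01 w1.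
have fw_seg k v : continuous (fun t : R => f (k + t%:C *: v) / wave (k + t%:C *: v) j : Co).
  apply: (@entire_segment R d (fun k => f k * (wave k j)^-1) k v).
  by apply: entireM => //; exact: entire_waveV.
(* Any two points of the region are joined by a segment inside it. *)
have same B Y k k' th th' : (forall k th, reg B Y k ->
    near_free f c k th -> normc (f k / wave k j - th j) < e) ->
    reg B Y k -> reg B Y k' -> near_free f c k th -> near_free f c k' th' ->
    th j = th' j.
  move=> cl kr kr' hth hth'.
  have /choice[T hT] (t : R) : exists T, near_free f c (k + t%:C *: (k' - k)) T /\
      (t = 0 -> T = th) /\ (t = 1 -> T = th').
    have [->|t0] := eqVneq t 0.
      exists th; split; first by rewrite scale0r addr0.
      by split=> // /esym/eqP; rewrite oner_eq0.
    have [->|t1] := eqVneq t 1.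
      exists th'; split; first by rewrite scale1r addrC subrK.
      by split=> // /eqP; rewrite oner_eq0.
    have [T hT] := fnear (k + t%:C *: (k' - k)).
    by exists T; split=> //; split=> /eqP; rewrite ?(negbTE t0) ?(negbTE t1).
  have -> : th = T 0 by have [_ [-> //]] := hT 0.
  have -> : th' = T 1 by have [_ [_ ->]] := hT 1.
  apply: (root_continuation (j := j) (th := fun t => T t j) (fw_seg k (k' - k))).
  move=> t /andP[t0 t1]; have [hTt _] := hT t; split; first by have [h _] := hTt; exact: h.
  apply: cl => //.
  have ImE i : complex.Im ((k + t%:C *: (k' - k)) 0 i) =
      (1 - t) * complex.Im (k 0 i) + t * complex.Im (k' 0 i).
    rewrite !mxE; case: (k 0 i) (k' 0 i) => [x y] [x' y']; rewrite /=; ring.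
  have [[k1 k2] [k1' k2']] := (kr, kr').
  split=> [i ij|]; rewrite ImE.
    have := k1 i ij; have := k1' i ij; rewrite !ler_norml => /andP[? ?] /andP[? ?].
    by apply/andP; split; nra.
  by nra.
have [Y0 Y00 cl0] := close 0 (lexx _).
pose base (Y : R) : 'rV[C]_d := (0 +i* - Y) *: delta_mx 0 j.
have base_reg B Y Y' : 0 <= B -> Y' <= Y -> reg B Y' (base Y).
  move=> B0 YY; split=> [i ij|]; rewrite !mxE /=.
    by rewrite (negbTE ij) mulr0 /= normr0.
  by rewrite eqxx mulr1 /= lerN2.
have [th0 hth0] := fnear (base Y0).
exists (th0 j) => B B0; have [Y Yge cl] := close B B0.
pose Y' := Num.max Y Y0.
exists Y' => k th kB kY hth.
have [th1 hth1] := fnear (base Y').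
have -> : th j = th1 j.
  apply: (same _ _ _ _ _ _ cl _ _ hth hth1).
    by split=> //; apply: le_trans kY _; rewrite lerN2 le_max lexx.
  by apply: base_reg => //; rewrite le_max lexx.
apply: (same _ _ _ _ _ _ cl0 _ _ hth1 hth0).
  by apply: base_reg => //; rewrite le_max lexx orbT.
exact: base_reg.
Qed.

End LeadingTerm.

Section Rigidity.
Variables (R : realType) (d : nat) (q : 'I_d -> nat).
Hypothesis q_gt0 : forall j, (0 < q j)%N.
Local Notation C := R[i].
Local Notation Co := (R[i])^o.
Local Notation wave := (axis_wave q).
Implicit Types (k : 'rV[C]_d) (th a b : 'I_d -> C).

Lemma waveN k j : wave (- k) j = (wave k j)^-1.
Proof. by rewrite /axis_wave mxE mulNr e2piN. Qed.

Lemma near_free_opp (f : 'rV[C]_d -> C) c k th : near_free q f c k th ->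
  near_free q (fun k => f (- k)) c (- k) (fun j => (th j)^-1).
Proof.
move=> [thq hth]; split=> [j|]; first by rewrite exprVn thq invr1.
rewrite opprK; apply: le_trans hth; rewrite le_eqVlt; apply/orP; left; apply/eqP.
congr (normc (_ - _)); apply: eq_bigr => j _.
by rewrite waveN -invfM invrK addrC.
Qed.

(** The coefficients come from [leading_root] for [f] and for its composition with
    the opposite. In the variable [k_j], the difference g is bounded: far
    below the real axis [th j = a j] cancels the growing term, far above it
    [th j ^-1 = b j] does, and in between every term is bounded. *)
Lemma near_free_laurent (f : 'rV[C]_d -> C) (c : R) : entire f ->
  (forall k, exists th, near_free q f c k th) ->
  exists a b : 'I_d -> C, exists l : C,
    [/\ forall j, a j ^+ q j = 1, forall j, b j ^+ q j = 1 &
    forall k, f k = l + \sum_j (a j * wave k j + b j * (wave k j)^-1)].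
Proof.
move=> fe fnear.
have fnearN k : exists th, near_free q (fun k => f (- k)) c k th.
  have [th hth] := fnear (- k); exists (fun j => (th j)^-1).
  by rewrite -[k]opprK; exact: near_free_opp.
have /choice[a ha] := leading_root q_gt0 fe fnear.
have /choice[b hb] := leading_root q_gt0 (entire_opp fe) fnearN.
(* Any point far enough down the j-th imaginary axis shows that a_j is a root of
   unity. *)
have aq j : a j ^+ q j = 1.
  have [Y hY] := ha j 0 (lexx _).
  have [th hth] := fnear ((0 +i* - Y) *: delta_mx 0 j).
  have <- : th j = a j; last by have [h _] := hth; exact: h.
  apply: hY hth => [i ij|]; rewrite !mxE /=.
    by rewrite (negbTE ij) mulr0 /= normr0.
  by rewrite eqxx mulr1.
have bq j : b j ^+ q j = 1.
  have [Y hY] := hb j 0 (lexx _).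
  have [th hth] := fnearN ((0 +i* - Y) *: delta_mx 0 j).
  have <- : th j = b j; last by have [h _] := hth; exact: h.
  apply: hY hth => [i ij|]; rewrite !mxE /=.
    by rewrite (negbTE ij) mulr0 /= normr0.
  by rewrite eqxx mulr1.
pose g k := f k - \sum_j (a j * wave k j + b j * (wave k j)^-1).
have ge : entire g.
  apply: entireB => //; apply: entire_sum => j; apply: entireD; apply: entireM;
    by [exact: entire_cst|exact: entire_wave|exact: entire_waveV].
exists a, b, (g 0); split=> // k.
suff <- : g k = g 0 by rewrite subrK.
apply: coordinatewise_constant => {}k j t.
pose B := \sum_i `|complex.Im (k 0 i)|.
have B0 : 0 <= B by apply: sumr_ge0.
have [Ya hYa] := ha j B B0; have [Yb hYb] := hb j B B0.
pose Y := `|Ya| + `|Yb|.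
pose E := expR (2 * pi * (B + Y)).
have E1 : 1 <= E.
  by rewrite -[leLHS]expR0 ler_expR mulr_ge0 ?addr_ge0// mulr_ge0// pi_ge0.
have -> : g k = g (k + (0 : Co) *: delta_mx 0 j) by rewrite scale0r addr0.
apply: (liouville (M := c + d%:R * (4 * E)) (entire_line k (delta_mx 0 j) ge)) => {}t.
set k' := k + t *: delta_mx 0 j.
have kI i : i != j -> `|complex.Im (k' 0 i)| <= B.
  move=> ij; rewrite !mxE (negbTE ij) mulr0 addr0 /B (bigD1 i)//= lerDl.
  exact: sumr_ge0.
have [th hth] := fnear k'; have [thq hc] := hth.
have nth i : normc (th i) = 1 by exact: (normc_root_unity (q_gt0 i) (thq i)).
have na i : normc (a i) = 1 by exact: (normc_root_unity (q_gt0 i) (aq i)).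
have nb i : normc (b i) = 1 by exact: (normc_root_unity (q_gt0 i) (bq i)).
have nV (z : C) : normc z = 1 -> normc z^-1 = 1 by move=> z1; rewrite normcV z1 invr1.
have -> : g k' = (f k' - twisted_free q k' th) +
    \sum_i ((th i - a i) * wave k' i + ((th i)^-1 - b i) * (wave k' i)^-1).
  have -> : \sum_i ((th i - a i) * wave k' i + ((th i)^-1 - b i) * (wave k' i)^-1) =
      twisted_free q k' th - \sum_i (a i * wave k' i + b i * (wave k' i)^-1).
    rewrite -sumrB; apply: eq_bigr => i _; rewrite [(th i * _)^-1]invfM.
    by move: (wave k' i) (wave k' i)^-1 (th i) (th i)^-1 (a i) (b i) => *; ring.
  by rewrite addrA subrK.
apply: le_trans (ler_normcD _ _) _; apply: lerD => //.
apply: le_trans (ler_normc_sum _ _ _) _.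
apply: (@le_trans _ _ (\sum_(i < d) 4 * E)); last by rewrite sumr_const card_ord -[leLHS]mulr_natl.
apply: ler_sum => i _; apply: le_trans (ler_normcD _ _) _.
have bnd (x y z : C) : normc x = 1 -> normc y = 1 -> x = y \/ normc z <= E ->
    normc ((x - y) * z) <= 2 * E.
  move=> x1 y1 [->|zE]; first by rewrite subrr mul0r normc0 mulr_ge0// (le_trans ler01).
  rewrite normcM ler_pM ?normc_ge0//; apply: le_trans (ler_normcB _ _) _.
  by rewrite x1 y1.
have bndA l z := bnd _ _ z (nth l) (na l).
have bndB l z := bnd _ _ z (nV _ (nth l)) (nb l).
have -> : 4 * E = 2 * E + 2 * E by lra.
have small : `|complex.Im (k' 0 i)| <= B + Y ->
    normc (wave k' i) <= E /\ normc (wave k' i)^-1 <= E.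
  by move=> h; exact: normc_wave_le.
have [ij|ij] := eqVneq i j; last first.
  have [h1 h2] : normc (wave k' i) <= E /\ normc (wave k' i)^-1 <= E.
    apply: small; apply: le_trans (kI i ij) _; rewrite lerDl addr_ge0//.
  by apply: lerD; [apply: bndA|apply: bndB]; right.
rewrite {}ij in small *.
have [/small[h1 h2]|far] := lerP `|complex.Im (k' 0 j)| (B + Y).
  by apply: lerD; [apply: bndA|apply: bndB]; right.
have p0 : 0 < 2 * pi :> R by rewrite mulr_gt0// pi_gt0.
have qR : 0 < (q j)%:R^-1 :> R by rewrite invr_gt0 ltr0n.
have [Im0|Im0] := lerP (complex.Im (k' 0 j)) 0.
  have thj : th j = a j.
    apply: hYa kI _ hth; move: far; rewrite ler0_norm// ltrNr => /ltW/le_trans; apply.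
    rewrite lerN2 /Y; have := ler_norm Ya; have := normr_ge0 Yb; lra.
  apply: lerD; [by apply: bndA; left|apply: bndB; right].
  apply: le_trans E1; rewrite normcV normc_wave -expRN opprK -[leRHS]expR0 ler_expR.
  by rewrite pmulr_rle0// pmulr_lle0.
have thj : (th j)^-1 = b j.
  apply: hYb (near_free_opp hth) => [m mj|]; first by rewrite mxE raddfN normrN kI.
  rewrite mxE raddfN lerN2; move: far; rewrite gtr0_norm// => /ltW; apply: le_trans.
  rewrite /Y; have := ler_norm Yb; have := normr_ge0 Ya; lra.
apply: lerD; [apply: bndA; right|by apply: bndB; left].
apply: le_trans E1; rewrite normc_wave -[leRHS]expR0 ler_expR oppr_le0.
by rewrite pmulr_rge0// pmulr_lge0// ltW.
Qed.

End Rigidity.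

(** * Simplicity of the free spectrum *)

Section SimpleSpectrum.
Variables (R : realType) (d : nat) (q : 'I_d -> nat).
Hypothesis q_gt0 : forall j, (0 < q j)%N.
Local Notation C := R[i].
Local Notation wave := (axis_wave q).
Local Notation free_eigenvalue := (free_eigenvalue q).
Local Notation Q := #|{: cell_index q}|.
Local Notation pt := (@cell d q).
Implicit Types (k : 'rV[C]_d) (V : zvec d -> R).

(** The logarithm provides a purely imaginary solution. *)
Lemma e2pi_real_pos (x : R) : 0 < x -> exists z : C, e2pi z = x%:C.
Proof.
move=> x0; have p0 : (2 * pi)%:C != 0 :> C.
  by rewrite fmorph_eq0 gt_eqF// mulr_gt0// pi_gt0.
exists (0 +i* - (ln x / (2 * pi))); rewrite /e2pi.
have -> : 2 * pi%:C * 'i%C * (0 +i* - (ln x / (2 * pi))) = (ln x)%:C :> C.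
  rewrite -(rmorph_nat (real_complex R)) -rmorphM; simpc.
  by rewrite mulrC divfK// gt_eqF// mulr_gt0// pi_gt0.
by rewrite /cexp /= lnK ?posrE// cos0 sin0; simpc.
Qed.

Lemma exists_waves (x : 'I_d -> R) : (forall j, 0 < x j) ->
  exists k, forall j, wave k j = (x j)%:C.
Proof.
move=> x0; have /choice[z hz] j : exists z : C, e2pi z = (x j)%:C.
  exact: e2pi_real_pos.
exists (\row_j (z j * (q j)%:R)) => j.
by rewrite /axis_wave mxE mulfK ?hz// q_neq0.
Qed.

Lemma nat_nonroot (p : {poly C}) : p != 0 -> exists n : nat, p.[n.+1%:R] != 0.
Proof.
move=> p0; apply: contrapT => /forallNP h.
have := @max_poly_roots _ p [seq i.+1%:R | i <- iota 0 (size p)] p0.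
rewrite size_map size_iota ltnn => H; suff : false by [].
apply: H.
  by apply/allP => _ /mapP[n _ ->]; apply/rootP/eqP; apply: contrapT => /negP/h.
rewrite map_inj_uniq ?iota_uniq// => i j /eqP.
by rewrite eqr_nat => /eqP[].
Qed.

(** If the wave in direction j is t^(j+1), the difference of two eigenvalues is a
    Laurent polynomial in t, and it is non-zero because distinct points of the
    cell have distinct roots of unity in some direction. A number t that is not a
    zero of any of these polynomials gives [k]. *)
Lemma simple_free_spectrum : exists k,
  injective (fun m : 'I_Q => free_eigenvalue (k + int_shift R (pt m))).
Proof.
pose r (m : 'I_Q) j : C := axis_wave q (int_shift R (pt m)) j.
pose P (a b : 'I_Q) : {poly C} := \sum_(j < d) ((r a j - r b j) *: 'X^(d + j.+1) +
  ((r a j)^-1 - (r b j)^-1) *: 'X^(d - j.+1)).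
have P0 a b : a != b -> P a b != 0.
  move=> ab; have [j jab] : exists j, cell a 0 j != cell b 0 j.
    apply: contrapT => /forallNP h; move/eqP: ab; apply; apply: (@cell_inj d q).
    by apply/rowP => j; apply/eqP; apply: contrapT => /negP/h.
  apply/eqP => /(congr1 (fun p : {poly C} => p`_(d + j.+1))).
  rewrite coef0 coef_sum (bigD1 j)//= big1 ?addr0 => [|i ij]; last first.
    rewrite coefD !coefZ !coefXn eqn_add2l eqSS.
    rewrite (_ : (j == i :> nat) = false) ?mulr0 ?add0r; last first.
      by rewrite eq_sym; apply/negbTE.
    by rewrite (_ : (_ == _)%N = false) ?mulr0//; apply/negbTE/eqP; have := ltn_ord i; lia.
  rewrite coefD !coefZ !coefXn eqxx mulr1.
  rewrite (_ : (_ == _)%N = false) ?mulr0 ?addr0; last first.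
    by apply/negbTE/eqP; have := ltn_ord j; lia.
  move/eqP; rewrite subr_eq0 /r !wave_int_shift// !mxE -!exprnP.
  rewrite (eq_prim_root_expr (root_unity_prim R (q_gt0 j))) !modn_small ?ltn_ord//.
  by move=> /eqP vab; move: jab; rewrite !mxE vab eqxx.
have [n] : exists n : nat, (\prod_(ab : 'I_Q * 'I_Q | ab.1 != ab.2) P ab.1 ab.2).[n.+1%:R] != 0.
  by apply: nat_nonroot; apply/prodf_neq0 => -[a b] /= /P0.
rewrite horner_prod => /prodf_neq0 nP.
have [k hk] := @exists_waves (fun j => n.+1%:R ^+ j.+1) (fun j => exprn_gt0 _ (ltr0Sn _ _)).
exists k => a b ab; apply/eqP; apply: contraT => nab.
have := nP (a, b) nab; rewrite /= /P horner_sum.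
have t0 : (n.+1%:R : C) != 0 by rewrite pnatr_eq0.
have -> : \sum_(j < d) ((r a j - r b j) *: 'X^(d + j.+1) +
   ((r a j)^-1 - (r b j)^-1) *: 'X^(d - j.+1)).[n.+1%:R] = n.+1%:R ^+ d *
   (free_eigenvalue (k + int_shift R (pt a)) - free_eigenvalue (k + int_shift R (pt b))).
  rewrite -sumrB mulr_sumr; apply: eq_bigr => j _.
  rewrite hornerD !hornerZ !hornerXn !waveD -/(r a j) -/(r b j) hk.
  rewrite rmorphXn rmorph_nat.
  have rn m : r m j != 0 by exact: wave_neq0.
  have -> : n.+1%:R ^+ (d - j.+1) = n.+1%:R ^+ d / n.+1%:R ^+ j.+1 :> C.
    have tj := expf_neq0 j.+1 t0.
    by apply: (mulIf tj); rewrite divfK// -exprD subnK.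
  rewrite exprD; move: (rn a) (rn b) (expf_neq0 j.+1 t0).
  move: (r a j) (r b j) (n.+1%:R ^+ j.+1) (n.+1%:R ^+ d) => x y t s x0 y0 tn0.
  by field; rewrite x0 y0 tn0.
by rewrite ab subrr mulr0 eqxx.
Qed.

End SimpleSpectrum.

(** * The two implications *)

Section Main.
Variables (R : realType) (d : nat) (q : 'I_d -> nat).
Hypothesis q_gt0 : forall j, (0 < q j)%N.
Local Notation C := R[i].
Local Notation wave := (axis_wave q).
Local Notation free_eigenvalue := (free_eigenvalue q).
Local Notation pt := (@cell d q).
Implicit Types (k : 'rV[C]_d) (V : zvec d -> R) (f : 'rV[C]_d -> C).

Lemma entire_free_eigenvalue (c : C) : entire (fun k => c + free_eigenvalue k).
Proof.
apply: entireD; first exact: entire_cst.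
by apply: entire_sum => j; apply: entireD; [exact: entire_wave|exact: entire_waveV].
Qed.

(** Reality on real quasimomenta forces the coefficients of [wave] and of its
    inverse to be conjugate. *)
Lemma real_laurent_conj (a b : 'I_d -> C) (l : C) f :
  (forall k, f k = l + \sum_j (a j * wave k j + b j * (wave k j)^-1)) ->
  (forall k, (forall j, complex.Im (k 0 j) = 0) -> (f k)^* = f k) ->
  forall j, b j = (a j)^*.
Proof.
move=> fE freal j.
pose k (x : R) : 'rV[C]_d := (x * (q j)%:R)%:C *: delta_mx 0 j.
have kreal x i : complex.Im (k x 0 i) = 0.
  by rewrite !mxE eqxx; case: (i == j); rewrite /= !(mulr0, mulr1, mul0r, addr0).
have wk x i : wave (k x) i = if i == j then e2pi x%:C else 1.
  rewrite /axis_wave !mxE eqxx; case: eqVneq => [->|_]; last by rewrite mulr0 mul0r e2pi0.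
  by rewrite mulr1 rmorphM rmorph_nat mulfK// q_neq0.
pose rest := \sum_(i | i != j) (a i + b i).
have fk x : f (k x) = l + rest + (a j * e2pi x%:C + b j * (e2pi x%:C)^-1).
  rewrite fE -addrA; congr (_ + _); rewrite (bigD1 j)//= addrC wk eqxx; congr (_ + _).
  by apply: eq_bigr => i /negbTE ij; rewrite wk ij invr1 !mulr1.
have e0 : e2pi (0 : R)%:C = 1 :> C by rewrite e2pi0.
have e12 : e2pi (2^-1 : R)%:C = -1 :> C.
  rewrite e2pi_real mulrAC divff// mul1r cospi sinpi.
  by apply/eqP; rewrite eq_complex /= oppr0 !eqxx.
have e14 : e2pi (4^-1 : R)%:C = 'i%C :> C.
  have -> : 4^-1 = 2^-1 / 2 :> R by rewrite -invfM -natrM.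
  rewrite e2pi_real (_ : 2 * pi * (2^-1 / 2) = pi / 2); last by field.
  by rewrite cos_pihalf sin_pihalf.
(* Only k_j varies, and its wave takes the values 1, -1 and i. *)
have re x : complex.Im (f (k x)) = 0.
  have := freal (k x) (kreal x); case: (f (k x)) => u v [] /eqP.
  by rewrite eq_sym -addr_eq0 -mulr2n mulrn_eq0 => /eqP.
have := re 0; have := re 2^-1; have := re 4^-1.
rewrite !fk e0 e12 e14; case: (a j) (b j) (l + rest) => [a1 a2] [b1 b2] [l1 l2].
simpc => /= h1 h2 h3.
rewrite !(expr0n, expr1n, sqrrN, addr0, add0r, divr1) /= in h1 h2 h3.
by congr (_ +i* _); lra.
Qed.

(** After the change of [k] into [k - s], the function is l plus the free eigenvalue,
    and integer translations of [k] produce all eigenvalues from this one. *)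
Lemma entire_bloch_constant V f : lattice_periodic q V -> entire f ->
  (forall k, bloch_variety q V (k, f k)) -> exists c : R, forall n, V n = c.
Proof.
move=> Vper fe hf.
have fnear k : exists th, near_free q f (\sum_a `|V (pt a)|) k th.
  have [m hm] := bloch_near_free q_gt0 (hf k).
  exists (axis_wave q (int_shift R (pt m))); split.
    by move=> j; rewrite wave_exp// floquet_factorE mxE e2pi_int.
  apply: le_trans hm; rewrite le_eqVlt; apply/orP; left; apply/eqP.
  by congr (normc (_ - _)); apply: eq_bigr => j _; rewrite waveD mulrC.
have [a [b [l [aq bq fE]]]] := near_free_laurent q_gt0 fe fnear.
have ba := real_laurent_conj fE (fun k kr => bloch_real q_gt0 kr (hf k)).
have aV j : b j = (a j)^-1.
  have a0 : a j != 0.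
    by apply: contra_eq_neq (aq j) => ->; rewrite expr0n gtn_eqF// eq_sym oner_eq0.
  apply: (mulfI a0); rewrite ba -sqr_normc normcE_C divff//.
  by rewrite (normc_root_unity (q_gt0 j) (aq j)) expr1n.
have /choice[n hn] j : exists n : nat, a j = e2pi (n%:~R / (q j)%:R).
  exact: root_unityP.
pose s : zvec d := \row_j (n j)%:Z.
have fs k : f k = l + free_eigenvalue (k + int_shift R s).
  rewrite fE; congr (_ + _); apply: eq_bigr => j _.
  rewrite waveD aV; have <- : a j = axis_wave q (int_shift R s) j.
    by rewrite hn /axis_wave !mxE.
  by rewrite (mulrC (wave k j)) [(a j * wave k j)^-1]invfM.
have hfree k : bloch_variety q V (k, l + free_eigenvalue k).
  apply: (bloch_int_shift q_gt0 (n := - s)).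
  have := hf (k + int_shift R (- s)); rewrite fs -addrA.
  by rewrite /int_shift -raddfD addNr raddf0 addr0.
have [k kinj] := simple_free_spectrum R q_gt0.
have Vl := isospectral_const q_gt0 kinj
  (fun m => bloch_int_shift q_gt0 (hfree (k + int_shift R (pt m)))).
exists (complex.Re l) => m; have [a0 a0E] := cell_surj q_gt0 m.
have diff : period_lattice q (m - pt a0).
  move=> j; rewrite a0E !mxE [X in X - _](divz_eq (m 0 j) (q j)) addrK.
  exact: dvdz_mull.
have <- : V (pt a0) = V m by rewrite -(Vper _ _ diff) addrC subrK.
by rewrite -(Vl a0).
Qed.

Lemma constant_bloch_entire V (c : R) : (forall n, V n = c) ->
  exists f, entire f /\ forall k, bloch_variety q V (k, f k).
Proof.
move=> Vc; exists (fun k => c%:C + free_eigenvalue k); split.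
  exact: entire_free_eigenvalue.
by move=> k; have -> : V = cst c by [exact/funext]; exact: free_bloch.
Qed.

End Main.

Theorem theorem1p2 (R : realType) (d : nat) (q : 'I_d -> nat)
    (V : zvec d -> R) :
  (1 <= d)%N -> (forall j, (0 < q j)%N) -> lattice_periodic q V ->
  (exists c : R, forall n, V n = c) <->
  (exists f : 'rV[R[i]]_d -> R[i],
     entire f /\ forall k, bloch_variety q V (k, f k)).
Proof.
move=> _ q_gt0 Vper; split=> [[c Vc]|[f [fe hf]]].
  exact: constant_bloch_entire Vc.
exact: entire_bloch_constant Vper fe hf.
Qed.
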